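(* Let $F$ be a balanced driver which does not depend on its $y$ argument (i.e. $c_t\equiv0$) and satisfies $F(\omega,t,y,0)=0$ $\mu\times\mathbb{P}$-a.s. For $Q\in L^2(\mathbb{R}^K;\mathcal{F}_T)$ and $t\in[0,T]$ define $\mathcal{E}(Q|\mathcal{F}_t)=Y_t$, where $(Y,Z)\in S^2\times H^2_M$ is the solution of the BSDE $$Q=Y_t-\int_{]t,T]}F(\omega,u,Y_{u-},Z_u)\,d\mu_u+\sum_{i=1}^\infty\int_{]t,T]}Z^i_u\,dM^i_u.$$ Then $\mathcal{E}(\cdot|\mathcal{F}_t)$, $0\le t\le T$, is an $\mathcal{F}_t$-consistent nonlinear expectation; that is, the family of operators $\mathcal{E}(\cdot|\mathcal{F}_t):L^2(\mathcal{F}_T)\to L^2(\mathcal{F}_t)$ ($L^2$ spaces of $\mathbb{R}^K$-valued variables) satisfies: (1) if $Q\ge\bar Q$ $\mathbb{P}$-a.s. componentwise, then $\mathcal{E}(Q|\mathcal{F}_t)\ge\mathcal{E}(\bar Q|\mathcal{F}_t)$ $\mathbb{P}$-a.s. componentwise, with equality iff $Q=\bar Q$ $\mathbb{P}$-a.s.; (2) for $Q\in L^2(\mathcal{F}_t)$, $\mathcal{E}(Q|\mathcal{F}_t)=Q$ $\mathbb{P}$-a.s.; (3) for any $s\le t$, $\mathcal{E}(\mathcal{E}(Q|\mathcal{F}_t)|\mathcal{F}_s)=\mathcal{E}(Q|\mathcal{F}_s)$ $\mathbb{P}$-a.s.; (4) for any $A\in\mathcal{F}_t$, $I_A\mathcal{E}(Q|\mathcal{F}_t)=\mathcal{E}(I_AQ|\mathcal{F}_t)$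 $\mathbb{P}$-a.s.
   Context: Setting: $T>0$ and $K\in\mathbb{N}$ are fixed. $(\Omega,\mathcal{F},\mathbb{P})$ is a probability space with a filtration $\{\mathcal{F}_t\}_{t\in[0,T]}$ satisfying the usual conditions, $\mathcal{F}_0$ trivial, and $L^2(\mathcal{F}_T)$ a separable Hilbert space. $M^1,M^2,\ldots$ is a fixed (finite or countable, padded by zeros) sequence of square-integrable martingales, as provided by the Davis–Varaiya martingale representation theorem: pairwise orthogonal ($\langle M^i,M^j\rangle=0$ for $i\ne j$); every square-integrable martingale $N$ can be written $N_t=N_0+\sum_i\int_{]0,t]}Z^i_u\,dM^i_u$ with predictable $Z^i$, $E[\sum_i\int_{[0,T]}(Z^i_u)^2d\langle M^i\rangle_u]<\infty$; and $\langle M^1\rangle\succ\langle M^2\rangle\succ\cdots$ (absolute continuity of each induced measure $A\mapsto E[\int_{[0,T]}I_A\,d\langle M^i\rangle]$ with respect to the preceding one). $\mathbb{R}^{K\times\infty}$ is the space of infinite sequences $z=(z^i)_{i\in\mathbb{N}}$, $z^i\in\mathbb{R}^K$; $\|\cdot\|$ is the Euclidean norm; $e_j$ is the $j$-th standard basis vector and $^*$ is transposition. $\mu$ is a deterministic nonnegative Stieltjes measure on $[0,T]$, positive on every nonempty open interval, identified with $\mu_t=\mu([0,t])$. With the Lebesgue decomposition $\langle M^i\rangle=m^{i,1}+m^{i,2}$ (as measures on the predictable $\sigma$-algebra), $m^{i,1}\ll\mu\times\mathbb{P}$, $m^{i,2}\perp\mu\times\mathbb{P}$, set $\|z_t\|^2_{M_t}:=\sum_i\|z^i_t\|^2\frac{dm^{i,1}_t}{d(\mu\times\mathbb{P})}$.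 $H^2_M$: predictable $\mathbb{R}^{K\times\infty}$-valued $Z$ with $E[\sum_i\int_{[0,T]}\|Z^i_t\|^2d\langle M^i\rangle_t]<\infty$. $S^2$: adapted $\mathbb{R}^K$-valued $Y$ with $E[\sup_t\|Y_t\|^2]<\infty$ (up to indistinguishability). A driver $F:\Omega\times[0,T]\times\mathbb{R}^K\times\mathbb{R}^{K\times\infty}\to\mathbb{R}^K$ is standard if it is predictable and progressively measurable, $E[\int_{]0,T]}\|F(\omega,t,0,0)\|^2d\mu_t]<\infty$, and there are $c\in\mathbb{R}$ and a deterministic measurable $c_t\le c$ with $\|F(\omega,t,y,z)-F(\omega,t,y',z')\|^2\le c_t\|y-y'\|^2+c\|z-z'\|^2_{M_t}$ $d\mu\times d\mathbb{P}$-a.s., and $c_t(\Delta\mu_t)^2<1$ for all $t$. For standard $F$ and $Q\in L^2(\mathbb{R}^K;\mathcal{F}_T)$ the BSDE has a unique solution in $S^2\times H^2_M$. A standard driver $F$ is balanced if for all $Y,\bar Y\in S^2$ and $Z,\bar Z\in H^2_M$: (iii) for each $j\in\{1,\dots,K\}$ there is a measure $\tilde{\mathbb{P}}_j$ equivalent to $\mathbb{P}$ such that $r\mapsto-\int_{]0,r]}e_j^*[F(\omega,u,\bar Y_{u-},Z_u)-F(\omega,u,\bar Y_{u-},\bar Z_u)]d\mu_u+\sum_i\int_{]0,r]}e_j^*[Z^i_u-\bar Z^i_u]dM^i_u$ is a $\tilde{\mathbb{P}}_j$-supermartingale on $[0,T]$; and (iv) if for all $r\in[0,T]$ and all $i$,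 $e_i^*Y_r-E_{\tilde{\mathbb{P}}_i}[\int_{]r,T]}e_i^*F(\omega,u,Y_{u-},Z_u)d\mu_u|\mathcal{F}_r]\ge e_i^*\bar Y_r-E_{\tilde{\mathbb{P}}_i}[\int_{]r,T]}e_i^*F(\omega,u,\bar Y_{u-},Z_u)d\mu_u|\mathcal{F}_r]$, then $Y_r\ge\bar Y_r$ componentwise for all $r\in[0,T]$. (When $F$ does not depend on $y$, (iv) is automatic.) *)

(* Defs.v *)
From HB Require Import structures.
From mathcomp Require Import all_boot all_order all_algebra.
From mathcomp Require Import all_classical all_reals all_analysis.

Set Implicit Arguments.
Unset Strict Implicit.
Unset Printing Implicit Defensive.

Import Order.TTheory GRing.Theory Num.Theory.
Import numFieldNormedType.Exports.

Local Open Scope classical_set_scope.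
Local Open Scope ring_scope.

(* Time is a real number and only the times t with 0 <= t <= T
   are ever constrained.  Processes are curried, time first: X t w.  The
   sequence M^1, M^2, ... is indexed from 0.  R^K is 'cV[R]_K, so e_j^* v is
   v j 0, and R^(K x oo) is nat -> 'cV[R]_K.

   The bracket <M^i> is given through the random measure it induces, a kernel
   m i from Omega to the line: <M^i>_t(w) = m i w `[0, t].  A deterministic
   integrator mu is likewise a measure, mu_t = mu `[0, t]. *)

Section vectors.
Context {R : realType} {K : nat}.

Definition sqnorm (v : 'cV[R]_K) : R := \sum_(k < K) v k 0 ^+ 2.

Definition cvle (u v : 'cV[R]_K) : Prop := forall k, u k 0 <= v k 0.

End vectors.

Section stochastic_basis.
Context {R : realType} (T : R).
Context {d : measure_display} {Omega : measurableType d}.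
Context (P : probability Omega R) (Ft : R -> set (set Omega)).
Implicit Types (r s t u : R) (X Y N A : R -> Omega -> R).
Implicit Types (G : set (set Omega)).

Definition usual_conditions : Prop :=
  [/\ forall t, 0 <= t <= T ->
        sigma_algebra setT (Ft t) /\ Ft t `<=` measurable,
      forall s t, 0 <= s -> s <= t -> t <= T -> Ft s `<=` Ft t,
      forall t B, 0 <= t < T -> (forall s, t < s <= T -> Ft s B) -> Ft t B
    & forall B, P.-negligible B -> Ft 0 B].

Definition trivial_sigma_algebra G : Prop :=
  forall B, G B -> P B = 0%E \/ P B = 1%E.

Definition wrt_measurable G (f : Omega -> R) : Prop :=
  forall B : set R, measurable B -> G (f @^-1` B).

Definition L2 G (f : Omega -> R) : Prop :=
  wrt_measurable G f /\ (\int[P]_w (f w ^+ 2)%:E < +oo)%E.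

Definition L2_separable G : Prop :=
  exists D : nat -> Omega -> R,
    (forall n, L2 G (D n)) /\
    forall f, L2 G f -> forall e : R, 0 < e ->
      exists n, (\int[P]_w ((f w - D n w) ^+ 2)%:E < e%:E)%E.

(* W is a version of the conditional expectation of V given G under Q. *)
Definition is_condexp (Q : probability Omega R) G (V W : Omega -> R) : Prop :=
  [/\ Q.-integrable setT (EFin \o V),
      Q.-integrable setT (EFin \o W),
      wrt_measurable G W
    & forall B, G B -> (\int[Q]_(w in B) (V w)%:E = \int[Q]_(w in B) (W w)%:E)%E].

Definition adapted X : Prop :=
  forall t, 0 <= t <= T -> wrt_measurable (Ft t) (X t).

Definition cadlag_path (f : R -> R) : Prop :=
  (forall t, 0 <= t < T -> f @ t^'+ --> f t) /\
  (forall t, 0 < t <= T -> cvg (f @ t^'-)).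

Definition cadlag X : Prop := {ae P, forall w, cadlag_path (X ^~ w)}.

Definition martingale X : Prop :=
  adapted X /\
  forall s t, 0 <= s -> s <= t -> t <= T -> is_condexp P (Ft s) (X t) (X s).

Definition supermartingale (Q : probability Omega R) X : Prop :=
  [/\ adapted X,
      forall t, 0 <= t <= T -> Q.-integrable setT (EFin \o X t)
    & forall s t, 0 <= s -> s <= t -> t <= T ->
        exists2 W, is_condexp Q (Ft s) (X t) W &
                   {ae Q, forall w, W w <= X s w}].

Definition sq_martingale X : Prop :=
  [/\ martingale X, cadlag X
    & forall t, 0 <= t <= T -> (\int[P]_w (X t w ^+ 2)%:E < +oo)%E].

Definition time_space : set (measurableTypeR R * Omega) :=
  `[0, T]%classic `*` setT.

Definition predictable_rectangles : set (set (measurableTypeR R * Omega)) :=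
  [set C | (exists2 B, Ft 0 B & C = [set 0] `*` B) \/
           exists s t B, [/\ 0 <= s, s <= t, t <= T, Ft s B &
                             C = `]s, t]%classic `*` B]].

(* R x Omega with the sigma-algebra generated by the rectangles above.  Since
   time_space is one of its sets, its trace on time_space is the predictable
   sigma-algebra of [0, T] x Omega. *)
Definition predictable_type := g_sigma_algebraType predictable_rectangles.

Definition predictable X : Prop :=
  measurable_fun (time_space : set predictable_type)
    (fun x : predictable_type => X x.1 x.2).

(* A = <X, Y>: the predictable process of finite variation, null at 0, such
   that X Y - A is a martingale. *)
Definition angle_bracket X Y A : Prop :=
  [/\ predictable A,
      {ae P, forall w, A 0 w = 0},
      {ae P, forall w, bounded_variation 0 T (A ^~ w)},
      {ae P, forall w, forall t, 0 <= t < T ->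
         A s w @[s --> t^'+] --> A t w}
    & martingale (fun t w => X t w * Y t w - A t w)].

Definition bracket_measure X (m : R.-sfker Omega ~> measurableTypeR R) : Prop :=
  (forall w, (m w `[0%R, T]%classic < +oo)%E) /\
  angle_bracket X X (fun t w => fine (m w `[0, t]%classic)).

(* A |-> E[\int_[0,T] I_A d<M>] *)
Definition induced_measure (m : R.-sfker Omega ~> measurableTypeR R)
    (C : set predictable_type) : \bar R :=
  (\int[P]_w \int[m w]_(t in `[0%R, T]) (\1_C (t, w))%:E)%E.

(* \sum_(k < n) phi_k 1_]s_k, t_k] *)
Record elementary := Elementary {
  el_size : nat ;
  el_coef : nat -> Omega -> R ;
  el_start : nat -> R ;
  el_stop : nat -> R }.

Definition is_elementary (H : elementary) : Prop :=
  forall k, (k < el_size H)%N ->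
    [/\ 0 <= el_start H k, el_start H k <= el_stop H k, el_stop H k <= T,
        wrt_measurable (Ft (el_start H k)) (el_coef H k)
      & exists b : R, forall w, `|el_coef H k w| <= b].

Definition el_process (H : elementary) : R -> Omega -> R := fun u w =>
  \sum_(k < el_size H)
    el_coef H k w * (el_start H k < u <= el_stop H k)%R%:R.

Definition el_integral (H : elementary) (M : R -> Omega -> R) :
    R -> Omega -> R := fun t w =>
  \sum_(k < el_size H) el_coef H k w *
    (M (Num.min (el_stop H k) t) w - M (Num.min (el_start H k) t) w).

(* N_t = \int_]0,t] Z dM, by extension of the Ito isometry from elementary
   integrands; m is the random measure of <M>.  N is determined up to
   indistinguishability. *)
Definition stoch_integral (M : R -> Omega -> R)
    (m : R.-sfker Omega ~> measurableTypeR R) (Z N : R -> Omega -> R) : Prop :=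
  [/\ adapted N, cadlag N &
      exists H : nat -> elementary,
        [/\ forall n, is_elementary (H n),
            (\int[P]_w \int[m w]_(u in `]0%R, T])
               ((el_process (H n) u w - Z u w) ^+ 2)%:E)%E @[n --> \oo] --> 0%E
          & forall t, 0 <= t <= T ->
            (\int[P]_w ((N t w - el_integral (H n) M t w) ^+ 2)%:E)%E
               @[n --> \oo] --> 0%E]].

(* I_t = \sum_i \int_]0,t] Z^i dM^i, the series converging in L^2. *)
Definition stoch_integral_sum (M : nat -> R -> Omega -> R)
    (m : nat -> R.-sfker Omega ~> measurableTypeR R)
    (Z : nat -> R -> Omega -> R) (I : R -> Omega -> R) : Prop :=
  [/\ adapted I, cadlag I &
      exists2 N : nat -> R -> Omega -> R,
        (forall i, stoch_integral (M i) (m i) (Z i) (N i))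
      & forall t, 0 <= t <= T ->
          (\int[P]_w ((I t w - \sum_(i < n) N i t w) ^+ 2)%:E)%E
             @[n --> \oo] --> 0%E].

(* The sequence of martingales of the Davis-Varaiya representation theorem,
   with their brackets. *)
Definition davis_varaiya (M : nat -> R -> Omega -> R)
    (m : nat -> R.-sfker Omega ~> measurableTypeR R) : Prop :=
  [/\ forall i, sq_martingale (M i) /\ bracket_measure (M i) (m i),
      forall i j, i <> j -> angle_bracket (M i) (M j) (fun _ _ => 0),
      forall N, sq_martingale N ->
        exists Z I, [/\ forall i, predictable (Z i),
          (\int[P]_w \sum_(i <oo) \int[m i w]_(t in `[0%R, T])
             (Z i t w ^+ 2)%:E < +oo)%E,
          stoch_integral_sum M m Z I
          & forall t, 0 <= t <= T -> {ae P, forall w, N t w = N 0 w + I t w}]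
    & forall i, induced_measure (m i.+1) `<< induced_measure (m i)].

Definition stieltjes_measure
    (mu : {finite_measure set (measurableTypeR R) -> \bar R}) : Prop :=
  mu (~` `[0, T]%classic) = 0%E /\
  forall a b : R, 0 <= a -> a < b -> b <= T -> (0 < mu `]a, b[%classic)%E.

(* phi = dm^1 / d(mu x P), where E[\int I_. d<M>] = m^1 + m^2 is the Lebesgue
   decomposition with respect to mu x P on the predictable sigma-algebra. *)
Definition ac_density
    (mu : {finite_measure set (measurableTypeR R) -> \bar R})
    (m : R.-sfker Omega ~> measurableTypeR R) (phi : R -> Omega -> R) : Prop :=
  let muP : set predictable_type -> \bar R := (mu \x P)%E in
  [/\ predictable phi,
      forall t w, 0 <= phi t w &
      exists m1 m2 : {measure set predictable_type -> \bar R},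
        [/\ forall C, measurable C -> induced_measure m C = (m1 C + m2 C)%E,
            m1 `<< muP,
            exists2 S, measurable S & muP S = 0%E /\ m2 (~` S) = 0%E
          & forall C : set predictable_type, measurable C ->
              m1 C = (\int[mu \x P]_(x in C) (phi x.1 x.2)%:E)%E]].

End stochastic_basis.

Section bsde.
Context {R : realType} {K : nat} (T : R).
Context {d : measure_display} {Omega : measurableType d}.
Context (P : probability Omega R) (Ft : R -> set (set Omega)).
Context (mu : {finite_measure set (measurableTypeR R) -> \bar R}).
Context (M : nat -> R -> Omega -> R).
Context (m : nat -> R.-sfker Omega ~> measurableTypeR R).
Context (phi : nat -> R -> Omega -> R).

Notation vec := 'cV[R]_K.
Notation driver := (R -> Omega -> vec -> (nat -> vec) -> vec).
Implicit Types (r s t u : R) (Y : R -> Omega -> vec) (Z : R -> Omega -> nat -> vec).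
Implicit Types (Q : Omega -> vec) (F : driver).

Definition L2vec (G : set (set Omega)) Q : Prop :=
  (forall k, wrt_measurable G (fun w => Q w k 0)) /\
  (\int[P]_w (sqnorm (Q w))%:E < +oo)%E.

Definition S2 Y : Prop :=
  [/\ forall k, adapted T Ft (fun t w => Y t w k 0),
      forall k, cadlag T P (fun t w => Y t w k 0)
    & (\int[P]_w ereal_sup [set (sqnorm (Y t w))%:E | t in `[0%R, T]%classic]
         < +oo)%E].

Definition H2 Z : Prop :=
  (forall i k, predictable T Ft (fun t w => Z t w i k 0)) /\
  (\int[P]_w \sum_(i <oo) \int[m i w]_(t in `[0%R, T])
     (sqnorm (Z t w i))%:E < +oo)%E.

Definition left_limit Y : R -> Omega -> vec := fun u w =>
  \col_k lim (Y s w k 0 @[s --> u^'-]).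

(* ||z||^2_{M_t} *)
Definition sqnormM (t : R) (w : Omega) (z : nat -> vec) : \bar R :=
  (\sum_(i <oo) (sqnorm (z i) * phi i t w)%:E)%E.

(* F restricted to D x R^K x R^(K x oo) is measurable for the product of the
   sigma-algebra on D generated by S with the Borel sigma-algebras. *)
Definition driver_measurable (D : set (measurableTypeR R * Omega))
    (S : set (set (measurableTypeR R * Omega))) F : Prop :=
  let X : Type := ((measurableTypeR R * Omega) * (vec * (nat -> vec)))%type in
  let space := [set x : X | D x.1] in
  let cylinders : set (set X) :=
    [set C | [\/ exists2 B, S B & C = [set x : X | B x.1],
                 exists k (B : set R), measurable B /\
                   C = space `&` [set x : X | B (x.2.1 k 0)]
               | exists i k (B : set R), measurable B /\
                   C = space `&` [set x : X | B (x.2.2 i k 0)]]] in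
  forall k (B : set R), measurable B ->
    <<s space, cylinders >>
      (space `&` [set x : X | B (F x.1.1 x.1.2 x.2.1 x.2.2 k 0)]).

Definition predictable_driver F : Prop :=
  driver_measurable (time_space T) (predictable_rectangles T Ft) F.

Definition progressive_driver F : Prop :=
  forall t, 0 <= t <= T ->
    driver_measurable (time_space t)
      [set C | exists A B, [/\ measurable A, A `<=` `[0, t], Ft t B &
                               C = A `*` B]] F.

Definition standard_driver F : Prop :=
  [/\ predictable_driver F,
      progressive_driver F,
      (\int[P]_w \int[mu]_(t in `]0%R, T])
         (sqnorm (F t w 0 (fun=> 0)))%:E < +oo)%E
    & exists (c : R) (ct : R -> R),
      [/\ measurable_fun `[0, T]%classic ct,
          forall t, 0 <= t <= T -> ct t <= c,
          {ae (mu \x P)%E, forall x, forall y y' z z',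
             ((sqnorm (F x.1 x.2 y z - F x.1 x.2 y' z'))%:E <=
              (ct x.1 * sqnorm (y - y'))%:E +
              c%:E * sqnormM x.1 x.2 (fun i => (z i - z' i)%R))%E}
        & forall t, 0 <= t <= T -> ct t * fine (mu [set t]) ^+ 2 < 1]].

Definition equivalent (P1 P2 : probability Omega R) : Prop :=
  P1 `<< P2 /\ P2 `<< P1.

(* e_j^* \int_]r,s] F(u, Y_{u-}, Z_u) dmu_u *)
Definition driver_integral F Y Z (j : 'I_K) (r s : R) (w : Omega) : R :=
  \int[mu]_(u in `]r, s]) F u w (left_limit Y u w) (Z u w) j 0.

(* The measures Pt depend on Y, Y', Z, Z', and the same ones serve in both
   clauses.  The premise of the last clause includes the existence of the
   conditional expectations that it compares. *)
Definition balanced F : Prop :=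
  standard_driver F /\
  forall Y Y' Z Z', S2 Y -> S2 Y' -> H2 Z -> H2 Z' ->
  exists Pt : 'I_K -> probability Omega R,
    [/\ forall j, equivalent P (Pt j),
        forall j I,
          stoch_integral_sum T P Ft M m
            (fun i u w => (Z u w i - Z' u w i) j 0) I ->
          supermartingale T Ft (Pt j) (fun r w =>
            - (\int[mu]_(u in `]0, r])
                 (F u w (left_limit Y' u w) (Z u w) -
                  F u w (left_limit Y' u w) (Z' u w)) j 0)
            + I r w)
      & (forall r i, 0 <= r <= T -> exists W W',
           [/\ is_condexp (Pt i) (Ft r) (driver_integral F Y Z i r T) W,
               is_condexp (Pt i) (Ft r) (driver_integral F Y' Z i r T) W'
             & {ae P, forall w, Y' r w i 0 - W' w <= Y r w i 0 - W w}]) ->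
        forall r, 0 <= r <= T -> {ae P, forall w, cvle (Y' r w) (Y r w)}].

Definition bsde_solution F Q Y Z : Prop :=
  [/\ S2 Y, H2 Z &
      forall j, exists2 I,
        stoch_integral_sum T P Ft M m (fun i u w => Z u w i j 0) I
      & forall t, 0 <= t <= T -> {ae P, forall w,
          Q w j 0 = Y t w j 0 - driver_integral F Y Z j t T w
                    + (I T w - I t w)}].

(* For Q in L^2(F_T), E Q is the component Y of the solution (Y, Z). *)
Definition bsde_expectation F (E : (Omega -> vec) -> R -> Omega -> vec) :=
  forall Q, L2vec (Ft T) Q -> exists Z, bsde_solution F Q (E Q) Z.

(* Independence of y, in the a.e. form expressed by c_t = 0. *)
Definition independent_of_y F : Prop :=
  {ae (mu \x P)%E, forall x, forall y y' z, F x.1 x.2 y z = F x.1 x.2 y' z}.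

Definition null_at_zero F : Prop :=
  {ae (mu \x P)%E, forall x, forall y, F x.1 x.2 y (fun=> 0) = 0}.

(* E Q t is E(Q | F_t), and the relations between random variables are almost
   sure, so the clauses also say that E respects almost sure equality. *)
Definition consistent_expectation
    (E : (Omega -> vec) -> R -> Omega -> vec) : Prop :=
  [/\ forall t Q, 0 <= t <= T -> L2vec (Ft T) Q -> L2vec (Ft t) (E Q t),
      forall t Q Q', 0 <= t <= T -> L2vec (Ft T) Q -> L2vec (Ft T) Q' ->
        {ae P, forall w, cvle (Q' w) (Q w)} ->
        {ae P, forall w, cvle (E Q' t w) (E Q t w)} /\
        ({ae P, forall w, E Q t w = E Q' t w} <->
         {ae P, forall w, Q w = Q' w}),
      forall t Q, 0 <= t <= T -> L2vec (Ft t) Q ->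
        {ae P, forall w, E Q t w = Q w},
      forall s t Q, 0 <= s -> s <= t -> t <= T -> L2vec (Ft T) Q ->
        {ae P, forall w, E (E Q t) s w = E Q s w}
    & forall t A Q, 0 <= t <= T -> Ft t A -> L2vec (Ft T) Q ->
        {ae P, forall w,
          \1_A w *: E Q t w = E (fun w' => \1_A w' *: Q w') t w}].

End bsde.

(* Main.v *)
Require Import Defs.
From HB Require Import structures.
From mathcomp Require Import all_boot all_order all_algebra finmap.
From mathcomp Require Import all_classical all_reals all_analysis.
From mathcomp Require Import measurable_realfun lra ring.

(** Let (Y, Z) and (Y', Z') solve the BSDE for Q and Q', and let A, A' be in F_s.
    Apply the balance condition to the integrands 1_A 1_]s, T] Z and
    1_A' 1_]s, T] Z'. Since F does not depend on y and vanishes at z = 0, the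
    resulting supermartingale X satisfies
      X_t - X_s = 1_A (Y_t - Y_s) - 1_A' (Y'_t - Y'_s)   for s <= t.
    Hence, for C measurable for F_s, nonnegativity of D := 1_A Y - 1_A' Y' + C at
    time t implies nonnegativity at time s, and if moreover D_s = 0 then D_t = 0.
    The four properties are the cases
      (1) A = A' = Omega, C = 0, t = T;     (2) A = Omega, A' empty, C = -Q, t = T;
      (3) A = A' = Omega, C = 0;            (4) A' = Omega, C = 0, t = T;
    in (2)-(4) D_t = 0, and exchanging the two solutions gives D_s = 0.
    The integrability in u of F(u, Z_u) comes from the Lipschitz bound
    |F(u, Z_u)|^2 <= c |Z_u|_M^2, whose right-hand side is integrable because the
    absolutely continuous part of d<M^i> is at most d<M^i>. *)

Set Implicit Arguments.
Unset Strict Implicit.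
Unset Printing Implicit Defensive.

Import Order.TTheory GRing.Theory Num.Theory.
Import numFieldNormedType.Exports.

Local Open Scope classical_set_scope.
Local Open Scope ring_scope.

(** * Integrals of arbitrary functions and measurability *)

(* Left limits of paths that are only almost surely cadlag are not known to be
   measurable, whence the lemmas on integrals of arbitrary functions. *)
Section integral_nonmeasurable.
Context {d : measure_display} {X : measurableType d} {R : realType}.
Variable mu : {measure set X -> \bar R}.
Local Open Scope ereal_scope.
Import HBNNSimple.

(** The integral of a nonnegative function is a supremum over the simple functions below it, so it
    is monotone without any measurability. *)
Lemma ge0_le_integralT (f g : X -> \bar R) :
  (forall x, 0 <= f x) -> (forall x, f x <= g x) ->
  \int[mu]_x f x <= \int[mu]_x g x.
Proof.
move=> f0 fg; rewrite !ge0_integralTE//; last by move=> x; exact: le_trans (fg x).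
by apply: le_ereal_sup => _ [h hf <-]; exists h => // x; exact: le_trans (fg x).
Qed.

(** A simple function below [f], set to zero on the null set [N], keeps its integral and lies below
    [g]. Taking suprema gives the inequality. *)
Lemma ge0_eq_off_null_le_integral (N : set X) (f g : X -> \bar R) :
  measurable N -> mu N = 0 -> (forall x, 0 <= f x) -> (forall x, 0 <= g x) ->
  (forall x, ~ N x -> f x = g x) -> \int[mu]_x f x <= \int[mu]_x g x.
Proof.
move=> mN muN f0 g0 fg; rewrite [leLHS]ge0_integralTE//.
apply: ge_ereal_sup => _ [h hf <-].
rewrite -integralT_nnsfun.
pose hN := proj_nnsfun h (measurableC mN).
have hNE x : hN x = (h \_ (~` N)) x by rewrite (mrestrict h (measurableC mN)).
rewrite (@ge0_ae_eq_integral _ _ _ mu setT _ (fun x => (hN x)%:E)) //.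
- apply: ge0_le_integralT => x; first by rewrite lee_fin.
  rewrite hNE /patch; case: ifPn => [/set_mem/= Nx|_ //].
  by rewrite -fg.
- exact/measurable_EFinP.
- exact/measurable_EFinP.
- by move=> x _; rewrite lee_fin.
- by move=> x _; rewrite lee_fin.
- exists N; split => // x; apply: contra_notP => Nx _.
  by rewrite hNE /patch mem_set.
Qed.

Lemma ae_eq_integral_nonmeasurable (D : set X) (f g : X -> \bar R) :
  {ae mu, forall x, D x -> f x = g x} ->
  \int[mu]_(x in D) f x = \int[mu]_(x in D) g x.
Proof.
move=> [N [mN N0 fgN]].
have fg x : ~ N x -> (f \_ D) x = (g \_ D) x.
  move=> Nx; rewrite /patch; case: ifPn => // /set_mem Dx.
  by apply: contra_notP Nx => fgx; apply: fgN => /=; apply: contra_not fgx; exact.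
(* After extension by zero outside [D], the previous inequality is used in both directions for the
   positive and for the negative parts. *)
rewrite integral_mkcond [RHS]integral_mkcond integralE [RHS]integralE.
congr (_ - _); apply/eqP; rewrite eq_le; apply/andP; split;
  apply: (@ge0_eq_off_null_le_integral N) => // x /fg E;
  by rewrite ?funeposE ?funenegE E.
Qed.

End integral_nonmeasurable.

Section integral_sqrB.
Context {d : measure_display} {X : measurableType d} {R : realType}.
Variable mu : {measure set X -> \bar R}.

Lemma sqrB_le2 (x y : R) : (x - y) ^+ 2 <= 2 * (x ^+ 2 + y ^+ 2).
Proof. by have := sqr_ge0 (x + y); rewrite !expr2; lra. Qed.

Lemma integral_sqrB_le (D : set X) (f g : X -> R) :
  measurable D -> measurable_fun D f -> measurable_fun D g ->
  (\int[mu]_(x in D) ((f x - g x) ^+ 2)%:E <=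
   2%:E * (\int[mu]_(x in D) (f x ^+ 2)%:E + \int[mu]_(x in D) (g x ^+ 2)%:E))%E.
Proof.
move=> mD mf mg.
have mf2 : measurable_fun D (fun x => (f x ^+ 2)%:E).
  by apply/measurable_EFinP; exact: measurable_funX.
have mg2 : measurable_fun D (fun x => (g x ^+ 2)%:E).
  by apply/measurable_EFinP; exact: measurable_funX.
rewrite -ge0_integralD//; last 2 first.
- by move=> x _; rewrite lee_fin sqr_ge0.
- by move=> x _; rewrite lee_fin sqr_ge0.
rewrite -ge0_integralZl//; last 2 first.
- exact: emeasurable_funD.
- by move=> x _; rewrite adde_ge0// lee_fin sqr_ge0.
apply: ge0_le_integral => //.
- by move=> x _; rewrite lee_fin sqr_ge0.
- by apply/measurable_EFinP; apply: measurable_funX; exact: measurable_funB.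
- by apply: measurable_funeM; exact: emeasurable_funD.
- by move=> x _; rewrite -EFinD -EFinM lee_fin sqrB_le2.
Qed.

End integral_sqrB.

(** * Measurability relative to a given sigma-algebra *)

Section relative_measurability.
Context {R : realType} {d : measure_display} {Omega : measurableType d}.
Variable G : set (set Omega).
Hypothesis sG : sigma_algebra setT G.

(** A sigma-algebra coincides with the one it generates, so the closure properties of measurable
    functions on the generated space carry over to [wrt_measurable]. *)
Lemma wrt_measurableP (f : Omega -> R) :
  wrt_measurable G f <->
  measurable_fun [set: g_sigma_algebraType G] (f : g_sigma_algebraType G -> R).
Proof.
split=> [Gf _ B mB|mf B mB].
  by rewrite setTI; apply: sub_sigma_algebra; exact: Gf.
have := mf measurableT _ mB; rewrite setTI.
by rewrite /measurable/= sigma_algebra_id.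
Qed.

Lemma wrt_measurable_cst (c : R) : wrt_measurable G (fun=> c).
Proof. by apply/wrt_measurableP; exact: measurable_cst. Qed.

Lemma wrt_measurableD (f g : Omega -> R) : wrt_measurable G f ->
  wrt_measurable G g -> wrt_measurable G (fun w => f w + g w).
Proof.
move=> /wrt_measurableP mf /wrt_measurableP mg; apply/wrt_measurableP.
exact: measurable_funD.
Qed.

Lemma wrt_measurableM (f g : Omega -> R) : wrt_measurable G f ->
  wrt_measurable G g -> wrt_measurable G (fun w => f w * g w).
Proof.
move=> /wrt_measurableP mf /wrt_measurableP mg; apply/wrt_measurableP.
exact: measurable_funM.
Qed.

Lemma wrt_measurableN (f : Omega -> R) : wrt_measurable G f ->
  wrt_measurable G (fun w => - f w).
Proof.
move=> /wrt_measurableP mf; apply/wrt_measurableP.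
exact: measurableT_comp.
Qed.

Lemma wrt_measurableB (f g : Omega -> R) : wrt_measurable G f ->
  wrt_measurable G g -> wrt_measurable G (fun w => f w - g w).
Proof. by move=> mf mg; apply: wrt_measurableD => //; exact: wrt_measurableN. Qed.

Lemma wrt_measurable_indic (A : set Omega) : G A -> wrt_measurable G (\1_A : Omega -> R).
Proof.
move=> GA; apply/wrt_measurableP; apply: (measurable_indic (T := g_sigma_algebraType G)).
exact: sub_sigma_algebra.
Qed.

Lemma wrt_measurableS (H : set (set Omega)) (f : Omega -> R) :
  G `<=` H -> wrt_measurable G f -> wrt_measurable H f.
Proof. by move=> GH mf B mB; apply/GH/mf. Qed.

Lemma wrt_measurable_measurable (f : Omega -> R) :
  G `<=` measurable -> wrt_measurable G f -> measurable_fun setT f.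
Proof. by move=> Gm mf _ B mB; rewrite setTI; apply/Gm/mf. Qed.

End relative_measurability.

(** * Supermartingales *)

Lemma ae_and {d} {X : measurableType d} {R : realType} (mu : {measure set X -> \bar R})
    (A B : X -> Prop) : {ae mu, forall x, A x} -> {ae mu, forall x, B x} ->
  {ae mu, forall x, A x /\ B x}.
Proof. by apply: filterS2 => x. Qed.

Lemma ae_dominates {d} {X : measurableType d} {R : realType}
    (P1 P2 : {measure set X -> \bar R}) (Q : X -> Prop) :
  P1 `<< P2 -> {ae P2, forall x, Q x} -> {ae P1, forall x, Q x}.
Proof.
move=> /null_content_dominatesP P12 [N [mN N0 QN]].
by exists N; split => //; exact: P12.
Qed.

Section supermartingale_comparison.
Context {R : realType} (T : R) {d : measure_display} {Omega : measurableType d}.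
Variables (P Pt : probability Omega R) (Ft : R -> set (set Omega)).
Hypothesis Ft_sigma : forall t : R, 0 <= t <= T ->
  sigma_algebra setT (Ft t) /\ Ft t `<=` measurable.
Hypothesis PPt : equivalent P Pt.
Variable X : R -> Omega -> R.
Hypothesis superX : supermartingale T Ft Pt X.
Variables (s t : R) (D : Omega -> R).
Hypotheses (s0 : 0 <= s) (st : s <= t) (tT : t <= T).
Hypothesis mD : wrt_measurable (Ft s) D.

(** In the application [D] is a difference of solutions at time s, and [V] is almost surely the same
    difference at time t. *)
Let V w := D w + (X t w - X s w).
Hypothesis V0 : {ae P, forall w, 0 <= V w}.

Let sT : 0 <= s <= T. Proof. by rewrite s0 (le_trans st). Qed.
Let tT' : 0 <= t <= T. Proof. by rewrite tT (le_trans s0). Qed.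
Let mDT : measurable_fun setT D.
Proof. by apply: wrt_measurable_measurable mD; exact: (Ft_sigma sT).2. Qed.

Let iX r : 0 <= r <= T -> Pt.-integrable setT (EFin \o X r).
Proof. by case: superX => _ + _; exact. Qed.

Let mV : measurable_fun setT V.
Proof.
apply: measurable_funD => //; apply: measurable_funB;
  by apply/measurable_EFinP; apply: (measurable_int Pt); exact: iX.
Qed.

(** A version [W] of the conditional expectation of X_t has the same integral as X_t over [B], and
    [W] is at most X_s off a null set, which is removed from both integrals. *)
Let integral_drift_le0 (B : set Omega) : Ft s B ->
  (\int[Pt]_(w in B) (X t w)%:E <= \int[Pt]_(w in B) (X s w)%:E)%E.
Proof.
move=> FB; have mB : measurable B by exact: (Ft_sigma sT).2.
case: superX => _ _ /(_ s t s0 st tT) [W [_ iW _ /(_ B FB) ->] [N [mN N0 WN]]].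
have iBW : Pt.-integrable B (EFin \o W) by apply: (integrableS measurableT mB (@subsetT _ B)) iW.
have iBX : Pt.-integrable B (EFin \o X s) by apply: (integrableS measurableT mB (@subsetT _ B)) (iX sT).
rewrite (negligible_integral mN mB iBW N0) (negligible_integral mN mB iBX N0).
have mBN : measurable (B `\` N) by exact: measurableD.
apply: le_integral => //.
- by apply: (integrableS mB mBN) iBW; exact: subDsetl.
- by apply: (integrableS mB mBN) iBX; exact: subDsetl.
move=> w /set_mem [Bw Nw] /=; rewrite lee_fin.
by apply: contra_notT Nw => ?; apply: WN => /=; exact/negP.
Qed.

(** [D] is not assumed integrable under [Pt]; on a set where it is bounded it is, and there the
    supermartingale increment can only lower the integral. *)
Let integral_V_le (B : set Omega) (c : R) : Ft s B ->
  (forall w, B w -> `|D w| <= c) ->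
  Pt.-integrable B (EFin \o D) /\
  (\int[Pt]_(w in B) (V w)%:E <= \int[Pt]_(w in B) (D w)%:E)%E.
Proof.
move=> FB Dc; have mB : measurable B by exact: (Ft_sigma sT).2.
have iD : Pt.-integrable B (EFin \o D).
  apply: (@le_integrable _ _ _ Pt B mB _ (EFin \o cst c)).
  - by apply/measurable_EFinP; exact: measurable_funTS.
  - move=> w Bw /=; rewrite lee_fin (le_trans (Dc _ Bw))// ler_norm//.
  - by apply: finite_measure_integrable_cst.
have iBt : Pt.-integrable B (EFin \o X t) by apply: (integrableS measurableT mB (@subsetT _ B)) (iX tT').
have iBs : Pt.-integrable B (EFin \o X s) by apply: (integrableS measurableT mB (@subsetT _ B)) (iX sT).
have iBd : Pt.-integrable B (EFin \o (fun w => X t w - X s w)).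
  by apply: (eq_integrable mB) (integrableB mB iBt iBs) => w _ /=; rewrite EFinB.
split=> //.
have -> : (\int[Pt]_(w in B) (V w)%:E = \int[Pt]_(w in B) (D w)%:E +
    (\int[Pt]_(w in B) (X t w)%:E - \int[Pt]_(w in B) (X s w)%:E))%E.
  by rewrite -integralB_EFin// -(integralD_EFin mB iD iBd).
have fs := integrable_fin_num mB iBs.
rewrite geeDl// sube_le0.
exact: integral_drift_le0.
Qed.

(** For B = {-n <= D < 0}, which lies in F_s, 0 <= E[V; B] <= E[D; B] <= 0. Hence D = 0 almost
    surely on B, where D < 0, so B is null. The sets B for all n cover {D < 0}. Null sets are the
    same for [P] and [Pt]. *)
Lemma supermartingale_comparison : {ae P, forall w, 0 <= D w}.
Proof.
have sPP : P `<< Pt by case: PPt.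
have V0' : {ae Pt, forall w, 0 <= V w} by apply: ae_dominates V0; case: PPt.
apply: (ae_dominates sPP).
have main (n : nat) : {ae Pt, forall w, ~ (- n%:R <= D w < 0)}.
  pose B := D @^-1` `[- n%:R, 0[%classic.
  have FB : Ft s B by apply: mD; exact: measurable_itv.
  have mB : measurable B by exact: (Ft_sigma sT).2.
  have DB w : B w -> `|D w| <= n%:R.
    rewrite /B /= in_itv /= => /andP[Dn D0].
    by rewrite ltr0_norm// lerNl.
  have [iD VD] := integral_V_le FB DB.
  have V_ge0 : (0 <= \int[Pt]_(w in B) (V w)%:E)%E.
    have -> : (\int[Pt]_(w in B) (V w)%:E = \int[Pt]_(w in B) `|V w|%:E)%E.
      apply: ae_eq_integral_nonmeasurable.
      by apply: filterS V0' => w Vw _; rewrite ger0_norm.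
    by apply: integral_ge0 => w _; rewrite lee_fin.
  have iD0 : (\int[Pt]_(w in B) `|(D w)%:E| = 0)%E.
    apply/eqP; rewrite eq_le integral_ge0 ?andbT; last by move=> w _.
    have -> : (\int[Pt]_(w in B) `|(D w)%:E| = - \int[Pt]_(w in B) (D w)%:E)%E.
      rewrite -integralN/=; last first.
        exact: (integrable_add_def mB iD).
      apply: eq_integral => w /set_mem; rewrite /B/= in_itv/= => /andP[_ D0].
      by rewrite ltr0_norm.
    by rewrite leeNl oppe0 (le_trans V_ge0).
  have /(ae_eq_integral_abs Pt mB) := iD0.
  move=> /(_ (measurable_int _ iD)); apply: filterS => w Dw0 /andP[Dn D0].
  have Bw : B w by rewrite /B/= in_itv/= Dn D0.
  by case: (Dw0 Bw) => Dw; move: D0; rewrite Dw ltxx.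
have : {ae Pt, forall w (n : nat), ~ (- n%:R <= D w < 0)}.
  exact/ae_foralln.
apply: filterS => w Dw; rewrite leNgt; apply/negP => D0.
apply: (Dw (Num.bound (- D w))); rewrite D0 andbT lerNl ltW// archi_boundP//.
by rewrite oppr_ge0 ltW.
Qed.

(** On B = {D = 0}, an event of F_s of full measure, 0 <= E[V; B] <= E[D; B] = 0, and the
    nonnegative [V] must vanish there. *)
Lemma supermartingale_comparison_eq0 : {ae P, forall w, D w = 0} ->
  {ae P, forall w, V w = 0}.
Proof.
move=> D0; have sPP : P `<< Pt by case: PPt.
have D0' : {ae Pt, forall w, D w = 0} by apply: ae_dominates D0; case: PPt.
have V0' : {ae Pt, forall w, 0 <= V w} by apply: ae_dominates V0; case: PPt.
apply: (ae_dominates sPP).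
have sFs : sigma_algebra setT (Ft s) := (Ft_sigma sT).1.
pose B := D @^-1` [set 0].
have FB : Ft s B by apply: mD; exact: measurable_set1.
have mB : measurable B by exact: (Ft_sigma sT).2.
have DB w : B w -> `|D w| <= 0 by rewrite /B /= => ->; rewrite normr0.
have [iD VD] := integral_V_le FB DB.
have iV0 : (\int[Pt]_(w in B) `|(V w)%:E| = 0)%E.
  apply/eqP; rewrite eq_le integral_ge0 ?andbT; last by move=> w _.
  have -> : (\int[Pt]_(w in B) `|(V w)%:E| = \int[Pt]_(w in B) (V w)%:E)%E.
    apply: ae_eq_integral_nonmeasurable.
    by apply: filterS V0' => w Vw _; rewrite /= ger0_norm.
  rewrite (le_trans VD)// integral0_eq// => w.
  by rewrite /B/= => ->.
have /(ae_eq_integral_abs Pt mB) := iV0.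
have mVB : measurable_fun B (EFin \o V).
  by apply/measurable_EFinP; exact: measurable_funTS.
move=> /(_ mVB); apply: filterS2 D0' => w Dw Vw.
by case: (Vw Dw).
Qed.

End supermartingale_comparison.

(** * Joint measurability *)

Lemma ge0_le_integral_nonmeasurable {d} {X : measurableType d} {R : realType}
    (mu : {measure set X -> \bar R}) (D : set X) (f g : X -> \bar R) :
  (forall x, D x -> 0 <= f x)%E -> (forall x, D x -> f x <= g x)%E ->
  (\int[mu]_(x in D) f x <= \int[mu]_(x in D) g x)%E.
Proof.
move=> f0 fg; rewrite !(integral_mkcond D); apply: ge0_le_integralT => x.
  exact: erestrict_ge0.
by rewrite /patch; case: ifPn => // /set_mem; exact: fg.
Qed.

Section joint_measurability.
Context {R : realType} (T : R) {d : measure_display} {Omega : measurableType d}.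
Variable Ft : R -> set (set Omega).
Hypothesis T0 : 0 <= T.
Hypothesis Ft_sigma : forall t : R, 0 <= t <= T ->
  sigma_algebra setT (Ft t) /\ Ft t `<=` measurable.

(** Measurability for the product sigma-algebra, which is what Tonelli and the integration against
    kernels require; predictability implies it. *)
Definition jointly_measurable (X : R -> Omega -> R) : Prop :=
  measurable_fun (time_space T : set (measurableTypeR R * Omega))
    (fun x => X x.1 x.2).

Lemma measurable_time_space :
  measurable (time_space T : set (measurableTypeR R * Omega)).
Proof. by apply: measurableX => //; exact: measurable_itv. Qed.

Lemma predictable_set_measurable (C : set (predictable_type T Ft)) :
  measurable C -> measurable (C : set (measurableTypeR R * Omega)).
Proof.
apply: smallest_sub; first exact: sigma_algebra_measurable.
move=> _ [[B FB ->]|[s [t [B [s0 st tT FB ->]]]]].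
  apply: measurableX; first exact: measurable_set1.
  by have [_] := Ft_sigma (t := 0) (introT andP (conj (lexx _) T0)); exact.
apply: measurableX; first exact: measurable_itv.
have sT : 0 <= s <= T by rewrite s0 (le_trans st).
by have [_] := Ft_sigma sT; exact.
Qed.

Lemma predictable_time_space :
  measurable (time_space T : set (predictable_type T Ft)).
Proof.
have FT t : 0 <= t <= T -> Ft t setT.
  by case/Ft_sigma => -[F0 FD _] _; rewrite -(setD0 setT); exact: FD.
have -> : (time_space T : set (R * Omega)) =
    ([set 0] `*` setT) `|` (`]0, T]%classic `*` setT).
  rewrite /time_space -(@setU1itv _ _ (BRight T) 0 false) ?bnd_simp//.
  by apply/seteqP; split => -[u w] /=; tauto.
apply: measurableU; apply: sub_sigma_algebra; [left|right].
  by exists setT => //; apply: FT; rewrite lexx.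
by exists 0, T, setT; split => //; apply: FT; rewrite lexx.
Qed.

Lemma predictable_jointly_measurable (X : R -> Omega -> R) :
  predictable T Ft X -> jointly_measurable X.
Proof.
move=> pX _ B mB; apply: predictable_set_measurable.
by apply: pX => //; exact: predictable_time_space.
Qed.

Lemma jointly_measurable_section (X : R -> Omega -> R) (w : Omega) (D : set R) :
  measurable D -> D `<=` `[0, T]%classic -> jointly_measurable X ->
  measurable_fun D (X ^~ w).
Proof.
move=> mD DT mX.
apply: (measurable_comp measurable_time_space _ mX (g := fun t => (t, w))) => //.
  by move=> _ [t Dt <-]; split => //=; exact: DT.
exact: measurable_funTS.
Qed.

Lemma jointly_measurableB (X Y : R -> Omega -> R) : jointly_measurable X ->
  jointly_measurable Y -> jointly_measurable (fun t w => X t w - Y t w).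
Proof. exact: measurable_funB. Qed.

(** The integrand is extended by zero outside [D] and its coordinates are exchanged, since a kernel
    from [Omega] integrates functions on the product with [Omega] as first factor. *)
Lemma measurable_kernel_integral (m : R.-sfker Omega ~> measurableTypeR R)
    (X : R -> Omega -> R) (D : set R) :
  measurable D -> D `<=` `[0, T]%classic -> jointly_measurable X ->
  (forall t w, 0 <= X t w) ->
  measurable_fun setT (fun w => \int[m w]_(t in D) (X t w)%:E)%E.
Proof.
move=> mD DT mX X0.
pose g : measurableTypeR R * Omega -> \bar R :=
  (fun y => (X y.1 y.2)%:E) \_ (D `*` setT).
pose k (x : Omega * measurableTypeR R) := g (x.2, x.1).
rewrite (_ : (fun w => _) = fun w => \int[m w]_t k (w, t))%E; last first.
  apply/funext => w; rewrite integral_mkcond; apply: eq_integral => t _.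
  rewrite /k /g /patch /=; congr (if _ then _ else _).
  by apply/idP/idP => /set_mem => [Dt|[Dt _]]; apply: mem_set.
apply: measurable_fun_integral_sfinite_kernel.
  by move=> x; rewrite /k /g; apply: erestrict_ge0 => y _; rewrite lee_fin.
have mDT : measurable (D `*` [set: Omega] : set (measurableTypeR R * Omega)).
  exact: measurableX.
suff mg : measurable_fun setT g.
  apply: (@measurableT_comp _ _ _ _ _ _ g _ (fun x => (x.2, x.1))) => //.
  exact: measurable_fun_pair.
apply/(measurable_restrictT _ mDT); apply/measurable_EFinP.
apply: measurable_funS mX; first exact: measurable_time_space.
by move=> x [Dx _]; split => //; exact: DT.
Qed.

End joint_measurability.

(** * Combining mean-square limits *)

Section integral_sqr_cvg.
Context {d : measure_display} {X : measurableType d} {R : realType}.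
Variable mu : {measure set X -> \bar R}.

Lemma cvge0_le2D (a b c : nat -> \bar R) : (forall n, 0 <= c n)%E ->
  (forall n, c n <= 2%:E * (a n + b n))%E ->
  a n @[n --> \oo] --> 0%E -> b n @[n --> \oo] --> 0%E ->
  c n @[n --> \oo] --> 0%E.
Proof.
move=> c0 cab a0 b0.
apply: (@squeeze_cvge _ _ _ _ (fun=> 0%E) _ (fun n => 2%:E * (a n + b n))%E).
- by apply: nearW => n; rewrite c0 cab.
- exact: cvg_cst.
- rewrite -[X in _ --> X](mule0 2%:E).
  apply: cvgeZl => //; rewrite -[X in _ --> X](adde0 0%E).
  exact: cvgeD.
Qed.

(** Here [f] and [g] are the errors of two approximations and [h] is the error of their combination.
    An inequality between squares, rather than h = f - g, leaves room for an indicator factor. *)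
Lemma cvg_integral_sqrB (f g h : nat -> X -> R) :
  (forall n, measurable_fun setT (f n)) -> (forall n, measurable_fun setT (g n)) ->
  (forall n x, h n x ^+ 2 <= (f n x - g n x) ^+ 2) ->
  (\int[mu]_x ((f n x) ^+ 2)%:E @[n --> \oo] --> 0)%E ->
  (\int[mu]_x ((g n x) ^+ 2)%:E @[n --> \oo] --> 0)%E ->
  (\int[mu]_x ((h n x) ^+ 2)%:E @[n --> \oo] --> 0)%E.
Proof.
move=> mf mg hfg; apply: cvge0_le2D => n.
  by apply: integral_ge0 => x _; rewrite lee_fin sqr_ge0.
apply: le_trans (integral_sqrB_le mu measurableT (mf n) (mg n)).
by apply: ge0_le_integral_nonmeasurable => x _; rewrite lee_fin ?sqr_ge0.
Qed.

End integral_sqr_cvg.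

(** * Stochastic integrals *)

Section processes.
Context {R : realType} (T : R) {d : measure_display} {Omega : measurableType d}.
Variables (P : probability Omega R) (Ft : R -> set (set Omega)).
Hypothesis T0 : 0 <= T.
Hypothesis Ft_sigma : forall t : R, 0 <= t <= T ->
  sigma_algebra setT (Ft t) /\ Ft t `<=` measurable.
Hypothesis Ft_nd : forall s t : R, 0 <= s -> s <= t -> t <= T -> Ft s `<=` Ft t.

(* When X is \int Z dM this is \int 1_A 1_]s, T] Z dM. *)
Definition restrict_process (A : set Omega) (s : R) (X : R -> Omega -> R) :
  R -> Omega -> R := fun r w => \1_A w * (X r w - X (Num.min r s) w).

Definition restrict_integrand (A : set Omega) (s : R) (Z : R -> Omega -> R) :
  R -> Omega -> R := fun u w => \1_A w * (s < u)%R%:R * Z u w.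

Lemma min_time (r s : R) : 0 <= r <= T -> 0 <= s -> 0 <= Num.min r s <= T.
Proof. by move=> /andP[r0 rT] s0; rewrite le_min r0 s0 ge_min rT. Qed.

Lemma adapted_measurable (X : R -> Omega -> R) t : adapted T Ft X ->
  0 <= t <= T -> measurable_fun setT (X t).
Proof.
by move=> aX tT; apply: wrt_measurable_measurable (aX _ tT); case: (Ft_sigma tT).
Qed.

Lemma adaptedB (X Y : R -> Omega -> R) : adapted T Ft X -> adapted T Ft Y ->
  adapted T Ft (fun r w => X r w - Y r w).
Proof.
move=> aX aY t tT; apply: wrt_measurableB; [|exact: aX|exact: aY].
by case: (Ft_sigma tT).
Qed.

(** Up to time s the restricted process is identically zero, and after s the event [A] belongs to
    the current sigma-algebra. *)
Lemma adapted_restrict (A : set Omega) (s : R) (X : R -> Omega -> R) :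
  0 <= s <= T -> Ft s A -> adapted T Ft X -> adapted T Ft (restrict_process A s X).
Proof.
move=> /andP[s0 sT] FA aX t /[dup] tT /andP[t0 tT'].
have [sF _] := Ft_sigma tT; rewrite /restrict_process.
have [ts|/ltW st] := leP t s.
  rewrite (_ : (fun w => _) = fun=> 0); first exact: wrt_measurable_cst.
  by apply/funext => w; rewrite subrr mulr0.
apply: wrt_measurableM => //.
  by apply: wrt_measurable_indic => //; exact: Ft_nd FA.
apply: wrt_measurableB => //; first exact: aX.
by apply: wrt_measurableS (aX s _); [exact: Ft_nd|rewrite s0 sT].
Qed.

Lemma cadlag_pathB (f g : R -> R) : cadlag_path T f -> cadlag_path T g ->
  cadlag_path T (fun r => f r - g r).
Proof.
move=> [fr fl] [gr gl]; split=> t tT.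
  by apply: cvgB; [exact: fr|exact: gr].
by apply: is_cvgB; [exact: fl|exact: gl].
Qed.

Lemma cadlag_path_scale (c : R) (f : R -> R) : cadlag_path T f ->
  cadlag_path T (fun r => c * f r).
Proof.
move=> [fr fl]; split=> t tT.
  by apply: cvgMr; exact: fr.
by apply: is_cvgMr; exact: fl.
Qed.

(** On the relevant side of t the stopped path agrees locally with [f] or with the constant f(s).
    The time t = s falls in the constant case for right limits and in the case of [f] for left
    limits. *)
Lemma cadlag_path_stopped (s : R) (f : R -> R) : cadlag_path T f ->
  cadlag_path T (fun r => f (Num.min r s)).
Proof.
move=> [fr fl]; split=> t /andP[t0 tT].
  have [ts|st] := ltP t s.
    apply: cvg_trans (fr t _); last by rewrite t0.
    apply: near_eq_cvg; near=> x; rewrite min_l//.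
    by near: x; exact: nbhs_right_le.
  apply: (@cvg_trans _ (cst (f s) @ t^'+)); last exact: cvg_cst.
  apply: near_eq_cvg; near=> x.
  suff tx : t <= x by rewrite min_r// (le_trans st).
  by near: x; exact: nbhs_right_ge.
have [ts|st] := leP t s.
  have /cvg_ex[l fl'] := fl t (introT andP (conj t0 tT)).
  apply/cvg_ex; exists l; apply: cvg_trans fl'.
  apply: near_eq_cvg; near=> x.
  suff xt : x <= t by rewrite min_l// (le_trans xt).
  by near: x; exact: nbhs_left_le.
apply/cvg_ex; exists (f s).
apply: (@cvg_trans _ (cst (f s) @ t^'-)); last exact: cvg_cst.
apply: near_eq_cvg; near=> x.
suff sx : s <= x by rewrite min_r.
by near: x; exact: nbhs_left_ge.
Unshelve. all: by end_near. Qed.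

Lemma cadlagB (X Y : R -> Omega -> R) : cadlag T P X -> cadlag T P Y ->
  cadlag T P (fun r w => X r w - Y r w).
Proof. by apply: filterS2 => w; exact: cadlag_pathB. Qed.

Lemma cadlag_restrict (A : set Omega) (s : R) (X : R -> Omega -> R) :
  cadlag T P X -> cadlag T P (restrict_process A s X).
Proof.
move=> cX; apply: filterS cX => w Xw; apply: cadlag_path_scale; apply: cadlag_pathB => //.
exact: (cadlag_path_stopped s Xw).
Qed.

Section stochastic_integrals.
Variables (M : R -> Omega -> R) (m : R.-sfker Omega ~> measurableTypeR R).
Hypothesis aM : adapted T Ft M.

Lemma elementary_jointly_measurable (H : elementary) :
  is_elementary T Ft H -> jointly_measurable T (el_process H).
Proof.
move=> eH; rewrite /jointly_measurable /el_process.
apply: measurable_sum => k; have [s0 st tT mc _] := eH k (ltn_ord k).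
apply: (@measurable_funS _ _ _ _ setT) => //.
apply: measurable_funM.
  apply: measurableT_comp measurable_snd; apply: wrt_measurable_measurable mc.
  by case: (@Ft_sigma (el_start H k)) => //; rewrite s0 (le_trans st).
rewrite (_ : (fun x => _) =
    (\1_(`]el_start H k, el_stop H k]%classic) : measurableTypeR R -> R) \o fst).
  by apply: measurableT_comp => //; exact: measurable_indic.
by apply/funext => x /=; rewrite indicE mem_setE in_itv.
Qed.

Lemma el_integral_measurable (H : elementary) t : is_elementary T Ft H ->
  0 <= t <= T -> measurable_fun setT (el_integral H M t).
Proof.
move=> eH tT; apply: measurable_sum => k.
have [s0 st stT mc _] := eH k (ltn_ord k); have /andP[t0 tT'] := tT.
apply: measurable_funM.
  apply: wrt_measurable_measurable mc.
  by case: (@Ft_sigma (el_start H k)) => //; rewrite s0 (le_trans st).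
by apply: measurable_funB; apply: adapted_measurable => //;
  rewrite le_min t0 ge_min tT' orbT ?s0 ?(le_trans s0).
Qed.

(** Raising both endpoints to at least s intersects each interval with ]s, oo[, leaving an empty one
    if it ends before s. The new starting time is at least s, so the factor 1_A is admissible in the
    coefficient. *)
Definition restrict_elementary (A : set Omega) (s : R) (H : elementary) :=
  Elementary (el_size H) (fun k w => \1_A w * el_coef H k w)
    (fun k => Num.max (el_start H k) s) (fun k => Num.max (el_stop H k) s).

Lemma restrict_is_elementary A s H : 0 <= s <= T -> Ft s A ->
  is_elementary T Ft H -> is_elementary T Ft (restrict_elementary A s H).
Proof.
move=> /andP[s0 sT] FA eH k kH; have [a0 ab bT mc [c cH]] := eH k kH.
have aT : el_start H k <= T by rewrite (le_trans ab).
have aT' : 0 <= Num.max (el_start H k) s <= T by rewrite le_max a0 ge_max aT.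
split => /=.
- by rewrite le_max a0.
- by rewrite ge_max !le_max ab lexx orbT.
- by rewrite ge_max bT.
- case/andP: (aT') => _ aT''; apply: wrt_measurableM.
  + by case: (Ft_sigma aT').
  + apply: wrt_measurable_indic; first by case: (Ft_sigma aT').
    by apply: Ft_nd FA => //; rewrite le_max lexx orbT.
  + by apply: wrt_measurableS mc; apply: Ft_nd => //; rewrite le_max lexx.
- exists c => w; rewrite normrM -[leRHS]mul1r ler_pM//.
  by rewrite indicE; case: (_ \in _); rewrite ?normr1 ?normr0.
Qed.

Lemma el_process_restrict A s H :
  el_process (restrict_elementary A s H) = restrict_integrand A s (el_process H).
Proof.
apply/funext => u; apply/funext => w.
rewrite /restrict_integrand /el_process mulr_sumr; apply: eq_bigr => k _ /=.
rewrite gt_max le_max -!mulrA; congr (_ * _); rewrite mulrCA; congr (_ * _).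
rewrite -natrM mulnb; congr (_ %:R); congr nat_of_bool.
have [su|us] := ltP s u; last by rewrite andbF.
by rewrite andbT orbF.
Qed.

Lemma el_integral_restrict A s H :
  el_integral (restrict_elementary A s H) M = restrict_process A s (el_integral H M).
Proof.
apply/funext => r; apply/funext => w.
rewrite /restrict_process /el_integral -sumrB mulr_sumr; apply: eq_bigr => k _ /=.
(* The last term does not depend on x, so it cancels in the difference between the two endpoints of
   an interval. *)
have stop x : M (Num.min (Num.max x s) r) w =
    M (Num.min x r) w - M (Num.min x (Num.min r s)) w + M (Num.min r s) w.
  have [rs|sr] := leP r s.
    by rewrite subrr add0r min_r// le_max rs orbT.
  have [xs|sx] := leP x s.
    have -> : Num.min x r = x by rewrite min_l// (le_trans xs)// ltW.
    have -> : Num.min s r = s by rewrite min_l// ltW.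
    by rewrite subrr add0r.
  by rewrite subrK.
by rewrite !stop; ring.
Qed.

Lemma stoch_integral_restrict A s Z N : 0 <= s <= T -> Ft s A ->
  stoch_integral T P Ft M m Z N ->
  stoch_integral T P Ft M m (restrict_integrand A s Z) (restrict_process A s N).
Proof.
move=> sT FA [aN cN [H [eH HZ HN]]].
split; [exact: adapted_restrict|exact: cadlag_restrict|].
exists (fun n => restrict_elementary A s (H n)); split.
- by move=> n; exact: restrict_is_elementary.
- apply: (@squeeze_cvge _ _ _ _ (fun=> 0%E)) HZ; last exact: cvg_cst.
  apply: nearW => n; rewrite integral_ge0/=; last first.
    by move=> w _; apply: integral_ge0 => u _; rewrite lee_fin sqr_ge0.
  apply: ge0_le_integral_nonmeasurable => w _.
    by apply: integral_ge0 => u _; rewrite lee_fin sqr_ge0.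
  apply: ge0_le_integral_nonmeasurable => u _; rewrite lee_fin ?sqr_ge0//.
  rewrite el_process_restrict /restrict_integrand -mulrBr exprMn.
  rewrite -[leRHS]mul1r; apply: ler_wpM2r; first exact: sqr_ge0.
  by rewrite indicE -natrM; case: (_ \in _); case: (_ < _); rewrite ?expr1n ?expr0n.
move=> t tT.
have s0 : 0 <= s by case/andP: sT.
have mT := min_time tT s0.
(* The error of the restricted integral at t is 1_A times the difference of the original errors at t
   and at min(t, s). *)
apply: cvg_integral_sqrB (HN t tT) (HN (Num.min t s) mT).
- by move=> n; apply: measurable_funB;
    [exact: adapted_measurable|exact: el_integral_measurable].
- by move=> n; apply: measurable_funB;
    [exact: adapted_measurable|exact: el_integral_measurable].
move=> n w; rewrite el_integral_restrict /restrict_process -mulrBr exprMn.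
have -> : forall a b c e : R, a - b - (c - e) = a - c - (b - e) by move=> *; ring.
rewrite -[leRHS]mul1r; apply: ler_wpM2r; first exact: sqr_ge0.
by rewrite indicE; case: (_ \in _); rewrite ?expr1n ?expr0n.
Qed.

(** The terms of [H2], with coefficients negated, are appended to those of [H1]; no common
    refinement of the intervals is required. *)
Definition elementaryB (H1 H2 : elementary) : elementary (R := R) (Omega := Omega) :=
  let n := el_size H1 in
  Elementary (n + el_size H2)
    (fun k w => if (k < n)%N then el_coef H1 k w else - el_coef H2 (k - n)%N w)
    (fun k => if (k < n)%N then el_start H1 k else el_start H2 (k - n)%N)
    (fun k => if (k < n)%N then el_stop H1 k else el_stop H2 (k - n)%N).

Lemma elementaryB_is_elementary H1 H2 : is_elementary T Ft H1 ->
  is_elementary T Ft H2 -> is_elementary T Ft (elementaryB H1 H2).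
Proof.
move=> e1 e2 k /=; case: (ltnP k (el_size H1)) => [k1 _|nk kn]; first exact: e1.
have [|a0 ab bT mc [c cH]] := e2 (k - el_size H1)%N; first by rewrite ltn_subLR.
split => //.
  apply: wrt_measurableN mc.
  by case: (@Ft_sigma (el_start H2 (k - el_size H1))) => //; rewrite a0 (le_trans ab).
by exists c => w; rewrite normrN.
Qed.

Lemma el_processB H1 H2 u w :
  el_process (elementaryB H1 H2) u w = el_process H1 u w - el_process H2 u w.
Proof.
rewrite /el_process big_split_ord/=; congr (_ + _).
  by apply: eq_bigr => k _; rewrite ltn_ord.
rewrite -sumrN; apply: eq_bigr => k _.
by rewrite ltnNge leq_addr/= addKn mulNr.
Qed.

Lemma el_integralB H1 H2 t w : el_integral (elementaryB H1 H2) M t w =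
  el_integral H1 M t w - el_integral H2 M t w.
Proof.
rewrite /el_integral big_split_ord/=; congr (_ + _).
  by apply: eq_bigr => k _; rewrite ltn_ord.
rewrite -sumrN; apply: eq_bigr => k _.
by rewrite ltnNge leq_addr/= addKn mulNr.
Qed.

(** Differences of the approximants work, by (a - b)^2 <= 2 (a^2 + b^2). Predictability supplies the
    measurability that splits the integral of the right-hand side into two. *)
Lemma stoch_integralB Z1 Z2 N1 N2 : predictable T Ft Z1 -> predictable T Ft Z2 ->
  stoch_integral T P Ft M m Z1 N1 -> stoch_integral T P Ft M m Z2 N2 ->
  stoch_integral T P Ft M m (fun u w => Z1 u w - Z2 u w)
    (fun r w => N1 r w - N2 r w).
Proof.
move=> pZ1 pZ2 [a1 c1 [H1 [e1 HZ1 HN1]]] [a2 c2 [H2 [e2 HZ2 HN2]]].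
split; [exact: adaptedB|exact: cadlagB|].
exists (fun n => elementaryB (H1 n) (H2 n)); split.
- by move=> n; exact: elementaryB_is_elementary.
- have mT : measurable `]0, T]%classic by exact: measurable_itv.
  have sT : (`]0, T]%classic : set R) `<=` `[0, T]%classic.
    by apply: subset_itvr; rewrite bnd_simp.
  have jZ1 n : jointly_measurable T (fun u w => el_process (H1 n) u w - Z1 u w).
    apply: jointly_measurableB; first exact: elementary_jointly_measurable.
    exact: predictable_jointly_measurable pZ1.
  have jZ2 n : jointly_measurable T (fun u w => el_process (H2 n) u w - Z2 u w).
    apply: jointly_measurableB; first exact: elementary_jointly_measurable.
    exact: predictable_jointly_measurable pZ2.
  have mI (X : R -> Omega -> R) : jointly_measurable T X -> measurable_fun setT
      (fun w => \int[m w]_(u in `]0%R, T]) (X u w ^+ 2)%:E)%E.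
    move=> jX; apply: (measurable_kernel_integral (T := T) m (X := fun u w => X u w ^+ 2)) => //.
      exact: measurable_funX.
    by move=> u w; exact: sqr_ge0.
  apply: cvge0_le2D HZ1 HZ2 => n.
    by apply: integral_ge0 => w _; apply: integral_ge0 => u _; rewrite lee_fin sqr_ge0.
  rewrite -ge0_integralD//; last 4 first.
  + by move=> w _; apply: integral_ge0 => u _; rewrite lee_fin sqr_ge0.
  + exact: mI (jZ1 n).
  + by move=> w _; apply: integral_ge0 => u _; rewrite lee_fin sqr_ge0.
  + exact: mI (jZ2 n).
  rewrite -ge0_integralZl//; last 2 first.
  + by apply: emeasurable_funD; [exact: mI (jZ1 n)|exact: mI (jZ2 n)].
  + by move=> w _; apply: adde_ge0;
      apply: integral_ge0 => u _; rewrite lee_fin sqr_ge0.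
  apply: ge0_le_integral_nonmeasurable => w _.
    by apply: integral_ge0 => u _; rewrite lee_fin sqr_ge0.
  have m1 := jointly_measurable_section w mT sT (jZ1 n).
  have m2 := jointly_measurable_section w mT sT (jZ2 n).
  apply: le_trans (integral_sqrB_le (m w) mT m1 m2).
  apply: ge0_le_integral_nonmeasurable => u _; rewrite lee_fin ?sqr_ge0//.
  rewrite el_processB le_eqVlt; apply/orP; left; apply/eqP; congr (_ ^+ 2); ring.
move=> t tT; apply: cvg_integral_sqrB (HN1 t tT) (HN2 t tT).
- by move=> n; apply: measurable_funB;
    [exact: adapted_measurable|exact: el_integral_measurable].
- by move=> n; apply: measurable_funB;
    [exact: adapted_measurable|exact: el_integral_measurable].
move=> n w; rewrite el_integralB le_eqVlt; apply/orP; left; apply/eqP.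
by congr (_ ^+ 2); ring.
Qed.

End stochastic_integrals.

Section stochastic_integral_series.
Variables (M : nat -> R -> Omega -> R) (m : nat -> R.-sfker Omega ~> measurableTypeR R).
Hypothesis aM : forall i, adapted T Ft (M i).

Lemma partial_sum_measurable (N : nat -> R -> Omega -> R) n t :
  (forall i, adapted T Ft (N i)) -> 0 <= t <= T ->
  measurable_fun setT (fun w => \sum_(i < n) N i t w).
Proof.
by move=> aN tT; apply: measurable_sum => i; apply: adapted_measurable.
Qed.

(** Restriction is linear, so it commutes with partial sums; the error of the series at t is again
    controlled by the errors at t and at min(t, s). *)
Lemma stoch_integral_sum_restrict A s Z I : 0 <= s <= T -> Ft s A ->
  stoch_integral_sum T P Ft M m Z I ->
  stoch_integral_sum T P Ft M m (fun i => restrict_integrand A s (Z i))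
    (restrict_process A s I).
Proof.
move=> sT FA [aI cI [N NZ NI]].
split; [exact: adapted_restrict|exact: cadlag_restrict|].
exists (fun i => restrict_process A s (N i)) => [i|t tT].
  exact: stoch_integral_restrict.
have aN i : adapted T Ft (N i) by case: (NZ i).
have s0 : 0 <= s by case/andP: sT.
have mT := min_time tT s0.
apply: cvg_integral_sqrB (NI t tT) (NI (Num.min t s) mT).
- by move=> n; apply: measurable_funB;
    [exact: adapted_measurable|exact: partial_sum_measurable].
- by move=> n; apply: measurable_funB;
    [exact: adapted_measurable|exact: partial_sum_measurable].
move=> n w; rewrite /restrict_process -mulr_sumr sumrB -mulrBr exprMn.
have -> : forall a b c e : R, a - b - (c - e) = a - c - (b - e) by move=> *; ring.
rewrite -[leRHS]mul1r; apply: ler_wpM2r; first exact: sqr_ge0.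
by rewrite indicE; case: (_ \in _); rewrite ?expr1n ?expr0n.
Qed.

Lemma stoch_integral_sumB Z1 Z2 I1 I2 :
  (forall i, predictable T Ft (Z1 i)) -> (forall i, predictable T Ft (Z2 i)) ->
  stoch_integral_sum T P Ft M m Z1 I1 -> stoch_integral_sum T P Ft M m Z2 I2 ->
  stoch_integral_sum T P Ft M m (fun i u w => Z1 i u w - Z2 i u w)
    (fun r w => I1 r w - I2 r w).
Proof.
move=> pZ1 pZ2 [a1 c1 [N1 NZ1 NI1]] [a2 c2 [N2 NZ2 NI2]].
split; [exact: adaptedB|exact: cadlagB|].
exists (fun i r w => N1 i r w - N2 i r w) => [i|t tT].
  exact: stoch_integralB.
have aN1 i : adapted T Ft (N1 i) by case: (NZ1 i).
have aN2 i : adapted T Ft (N2 i) by case: (NZ2 i).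
apply: cvg_integral_sqrB (NI1 t tT) (NI2 t tT).
- by move=> n; apply: measurable_funB;
    [exact: adapted_measurable|exact: partial_sum_measurable].
- by move=> n; apply: measurable_funB;
    [exact: adapted_measurable|exact: partial_sum_measurable].
move=> n w; rewrite sumrB le_eqVlt; apply/orP; left; apply/eqP.
by congr (_ ^+ 2); ring.
Qed.

End stochastic_integral_series.
End processes.

(** * Absolutely continuous parts of the brackets *)

Section densities.
Context {R : realType} (T : R) {d : measure_display} {Omega : measurableType d}.
Variables (P : probability Omega R) (Ft : R -> set (set Omega)).
Variable mu : {finite_measure set (measurableTypeR R) -> \bar R}.
Hypothesis T0 : 0 <= T.
Hypothesis Ft_sigma : forall t : R, 0 <= t <= T ->
  sigma_algebra setT (Ft t) /\ Ft t `<=` measurable.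
Variables (m : R.-sfker Omega ~> measurableTypeR R) (phi : R -> Omega -> R).
Hypothesis phi_density : ac_density T P Ft mu m phi.

Let X := (measurableTypeR R * Omega)%type.
Let D : set X := time_space T.
Let mD : measurable D. Proof. exact: measurable_time_space. Qed.
Let phi0 u w : 0 <= phi u w. Proof. by case: phi_density. Qed.
Let mphi : measurable_fun D (fun x : X => phi x.1 x.2).
Proof.
by case: phi_density => pphi _ _; apply: (predictable_jointly_measurable T0 Ft_sigma).
Qed.

Import HBNNSimple.

Let indic_jointly_measurable (C : set (predictable_type T Ft)) : measurable C ->
  jointly_measurable T (fun u w => \1_C (u, w) : R).
Proof.
move=> mC; have mC' := predictable_set_measurable T0 Ft_sigma mC.
rewrite /jointly_measurable (_ : (fun x => _) = (\1_(C : set X) : X -> R)).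
  exact: measurable_indic.
by apply/funext => -[].
Qed.

(** The left side is the absolutely continuous part [m1] of the induced measure on the part of [C]
    in the time space, and the singular part [m2] is nonnegative. *)
Lemma density_indic_le (C : set (predictable_type T Ft)) : measurable C ->
  (\int[mu \x P]_(x in D) (\1_C x * phi x.1 x.2)%:E <=
   \int[P]_w \int[m w]_(t in `[0%R, T]) (\1_C (t, w))%:E)%E.
Proof.
move=> mC; have mC' := predictable_set_measurable T0 Ft_sigma mC.
have mDC : measurable (D `&` C : set (predictable_type T Ft)).
  by apply: measurableI => //; exact: predictable_time_space.
case: phi_density => _ _ [m1 [m2 [dec _ _ m1E]]].
have -> : (\int[mu \x P]_(x in D) (\1_C x * phi x.1 x.2)%:E = m1 (D `&` C))%E.
  rewrite (m1E _ mDC); pose phiE (x : X) := (phi x.1 x.2)%:E.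
  transitivity (\int[mu \x P]_(x in D) (phiE \_ (C : set X)) x)%E.
    apply: eq_integral => x _; rewrite /phiE /patch indicE.
    by case: ifPn => xC; rewrite ?mul1r ?mul0r.
  by rewrite -integral_mkcondr.
have le1 : (m1 (D `&` C) <= @induced_measure R T d Omega P Ft m (D `&` C))%E.
  by rewrite (dec _ mDC) leeDl.
apply: (le_trans le1).
rewrite /induced_measure; apply: ge0_le_integral_nonmeasurable => w _.
  by apply: integral_ge0 => t _; rewrite lee_fin.
apply: ge0_le_integral_nonmeasurable => t _; rewrite lee_fin//.
by rewrite !indicE in_setI ler_nat; case: (_ \in D); rewrite ?andbT.
Qed.

(** By linearity from the indicators of the level sets of [h], which are predictable. *)
Lemma density_nnsfun_le (h : {nnsfun (predictable_type T Ft) >-> R}) :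
  (\int[mu \x P]_(x in D) (h x * phi x.1 x.2)%:E <=
   \int[P]_w \int[m w]_(t in `[0%R, T]) (h (t, w))%:E)%E.
Proof.
pose s := enum_fset (fset_set (range h)).
pose A (y : R) := h @^-1` [set y].
have mA y : measurable (A y) by exact: measurable_funPTI.
have mA' y : measurable (A y : set X) := predictable_set_measurable T0 Ft_sigma (mA y).
(* |y| instead of y makes every term nonnegative, whether y is in the range or not. *)
have hE x : h x = \sum_(y <- s) (`|y| * \1_(A y) x).
  rewrite fimfunE fsbig_finite//=; apply: eq_big_seq => y.
  by rewrite in_fset_set// => /set_mem[z _ <-]; rewrite ger0_norm.
have -> : (\int[mu \x P]_(x in D) (h x * phi x.1 x.2)%:E =
    \sum_(i <- s) `|i|%:E * \int[mu \x P]_(x in D) (\1_(A i) x * phi x.1 x.2)%:E)%E.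
  have mI (i : R) : measurable_fun D (fun x : X => \1_(A i) x * phi x.1 x.2).
    by apply: measurable_funM => //; exact: measurable_indic.
  under eq_integral do rewrite hE mulr_suml -sumEFin.
  rewrite ge0_integral_sum//.
  - apply: eq_bigr => i _; rewrite -ge0_integralZl//.
    + by apply: eq_integral => x _; rewrite -EFinM mulrA.
    + exact/measurable_EFinP.
    + by move=> x _; rewrite lee_fin mulr_ge0.
  - move=> i; apply/measurable_EFinP; under eq_fun do rewrite -mulrA.
    by apply: measurable_funM => //; exact: mI.
  - by move=> i x _; rewrite lee_fin !mulr_ge0.
have -> : (\int[P]_w \int[m w]_(t in `[0%R, T]) (h (t, w))%:E =
    \sum_(i <- s) `|i|%:E * \int[P]_w \int[m w]_(t in `[0%R, T]) (\1_(A i) (t, w))%:E)%E.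
  have mT : measurable (`[0, T]%classic : set R) by exact: measurable_itv.
  have mS i w : measurable_fun `[0, T] (fun t : measurableTypeR R => \1_(A i) (t, w) : R).
    by apply: (jointly_measurable_section w mT (@subset_refl _ _) (indic_jointly_measurable (mA i))).
  have mK i : measurable_fun setT
      (fun w => \int[m w]_(t in `[0%R, T]) (\1_(A i) (t, w))%:E)%E.
    by apply: (measurable_kernel_integral m mT (@subset_refl _ _) (indic_jointly_measurable (mA i))).
  transitivity (\int[P]_w \sum_(i <- s)
      (`|i|%:E * \int[m w]_(t in `[0%R, T]) (\1_(A i) (t, w))%:E))%E.
    apply: eq_integral => w _.
    under eq_integral do rewrite hE -sumEFin.
    rewrite ge0_integral_sum//.
      apply: eq_bigr => i _; rewrite -ge0_integralZl//.
      by apply/measurable_EFinP; exact: mS.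
    by move=> i; apply/measurable_EFinP; apply: measurable_funM => //; exact: mS.
  rewrite ge0_integral_sum//.
  - apply: eq_bigr => i _; rewrite -ge0_integralZl//.
    + by move=> w _; apply: integral_ge0 => t _; rewrite lee_fin.
  - by move=> i; exact: measurable_funeM.
  - move=> i w _; apply: mule_ge0; first by rewrite lee_fin.
    by apply: integral_ge0 => t _; rewrite lee_fin.
apply: lee_sum => i _; apply: lee_wpmul2l; first by rewrite lee_fin.
exact: density_indic_le.
Qed.

(** Simple functions for the predictable sigma-algebra increase to [f]. Monotone convergence is
    applied on the left only; on the right each approximation is simply bounded by [f]. *)
Lemma density_integral_le (f : R -> Omega -> R) : predictable T Ft f ->
  (forall u w, 0 <= f u w) ->
  (\int[mu \x P]_(x in D) (f x.1 x.2 * phi x.1 x.2)%:E <=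
   \int[P]_w \int[m w]_(t in `[0%R, T]) (f t w)%:E)%E.
Proof.
move=> pf f0.
have mDp := predictable_time_space T0 Ft_sigma.
have mfp : measurable_fun (D : set (predictable_type T Ft))
    (fun x : predictable_type T Ft => (f x.1 x.2)%:E) by exact/measurable_EFinP.
pose g := nnsfun_approx mDp mfp.
have f0' (x : predictable_type T Ft) : D x -> (0 <= (f x.1 x.2)%:E)%E.
  by move=> _; rewrite lee_fin.
have gf x : D x -> (g n x)%:E @[n --> \oo] --> (f x.1 x.2)%:E.
  by move=> Dx; exact: (cvg_nnsfun_approx mDp mfp f0' Dx).
have ndg (x : predictable_type T Ft) : {homo g ^~ x : k n / (k <= n)%N >-> k <= n}.
  by move=> k n kn; have /lefP := nd_nnsfun_approx mDp mfp kn; exact.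
have gle n x : D x -> g n x <= f x.1 x.2.
  move=> Dx; rewrite -lee_fin -(cvg_lim _ (gf x Dx))//.
  apply: lime_ge; last by exists n => // k /= nk; rewrite lee_fin; exact: ndg.
  by apply: ereal_nondecreasing_is_cvgn => k l kl; rewrite lee_fin; exact: ndg.
have mg n : measurable_fun (D : set X) (g n).
  move=> _ B mB; apply: (predictable_set_measurable T0 Ft_sigma).
  by apply: measurableI => //; exact: measurable_funPTI.
have -> : (\int[mu \x P]_(x in D) (f x.1 x.2 * phi x.1 x.2)%:E =
    limn (fun n => \int[mu \x P]_(x in D) (g n x * phi x.1 x.2)%:E))%E.
  rewrite -monotone_convergence//.
  - apply: eq_integral => x /set_mem Dx; apply/esym/cvg_lim => //.
    under eq_fun do rewrite EFinM.
    rewrite EFinM; apply: cvgeZr => //; exact: gf.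
  - by move=> n; apply/measurable_EFinP; exact: measurable_funM.
  - by move=> n x _; rewrite lee_fin mulr_ge0.
  - by move=> x _ k n kn; rewrite lee_fin ler_wpM2r//; exact: ndg.
apply: lime_le.
  apply: ereal_nondecreasing_is_cvgn => k n kn.
  apply: ge0_le_integral_nonmeasurable => x _; rewrite lee_fin ?mulr_ge0//.
  by rewrite ler_wpM2r//; exact: ndg.
apply: nearW => n; apply: le_trans (density_nnsfun_le (g n)) _.
apply: ge0_le_integral_nonmeasurable => w _.
  by apply: integral_ge0 => t _; rewrite lee_fin.
apply: ge0_le_integral_nonmeasurable => t tT; rewrite lee_fin//.
exact: (gle n (t, w)).
Qed.

End densities.

(** * Integrability of the driver *)

(** By Tonelli the measures of the sections of a null set integrate to 0, so almost every section is
    null. *)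
Lemma ae_product_section {d1 d2} {X : measurableType d1} {Y : measurableType d2}
    {R : realType} (mu : {finite_measure set X -> \bar R}) (P : probability Y R)
    (Q : X * Y -> Prop) :
  {ae (mu \x P)%E, forall x, Q x} ->
  {ae P, forall y, {ae mu, forall x, Q (x, y)}}.
Proof.
move=> [N [mN N0 QN]].
have muN0 : (\int[P]_y `|(mu \o ysection N) y| = 0)%E.
  under eq_integral do rewrite gee0_abs//.
  rewrite -indic_fubini_tonelli_GE//.
  have := indic_fubini_tonelli mu P mN; rewrite /fubini_G => <-.
  by rewrite -indic_fubini_tonelli1// integral_indic// setIT.
have /(ae_eq_integral_abs P measurableT) := muN0.
move=> /(_ (measurable_fun_ysection mu mN)).
apply: filterS => y /(_ I) muy0.
exists (ysection N y); split => //; first exact: measurable_ysection.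
by move=> x /= nQ; rewrite ysectionE /=; exact: QN.
Qed.

Section drivers.
Context {R : realType} {K : nat} (T : R).
Context {d : measure_display} {Omega : measurableType d}.
Variables (P : probability Omega R) (Ft : R -> set (set Omega)).
Variable mu : {finite_measure set (measurableTypeR R) -> \bar R}.
Variables (m : nat -> R.-sfker Omega ~> measurableTypeR R)
  (phi : nat -> R -> Omega -> R).
Variable F : R -> Omega -> 'cV[R]_K -> (nat -> 'cV[R]_K) -> 'cV[R]_K.
Hypothesis T0 : 0 <= T.
Hypothesis Ft_sigma : forall t : R, 0 <= t <= T ->
  sigma_algebra setT (Ft t) /\ Ft t `<=` measurable.
Hypothesis phi_density : forall i, ac_density T P Ft mu (m i) (phi i).
Hypothesis stdF : standard_driver T P Ft mu phi F.
Hypothesis nullF : null_at_zero P mu F.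

Let X := (measurableTypeR R * Omega)%type.
Let D : set X := time_space T.
Let mD : measurable D. Proof. exact: measurable_time_space. Qed.

Section integrand.
Variable Z : R -> Omega -> nat -> 'cV[R]_K.
Hypothesis H2Z : H2 T P Ft m Z.

(** The sets whose preimage under [g] is measurable within [D] form a sigma-algebra, so only the
    generating cylinders have to be checked. The argument y is frozen at 0, which avoids the left
    limits of Y. *)
Lemma driver_jointly_measurable (j : 'I_K) :
  jointly_measurable T (fun u w => F u w 0 (Z u w) j 0).
Proof.
move=> _ B mB; case: stdF => pF _ _ _.
pose g (x : X) := (x, (0 : 'cV[R]_K, Z x.1 x.2)).
have := pF j B mB.
set S := <<s _, _ >> => SB.
suff S_measurable C : S C -> measurable (D `&` g @^-1` C).
  move: SB => /S_measurable; rewrite (_ : D `&` g @^-1` _ = D `&`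
    (fun x : X => F x.1 x.2 0 (Z x.1 x.2) j 0) @^-1` B)//.
  by rewrite /g; apply/seteqP; split => x /=; tauto.
apply: (@smallest_sub _ _ _ [set C | measurable (D `&` g @^-1` C)]).
  split => /=.
  - by rewrite preimage_set0 setI0.
  - move=> E mE; rewrite (_ : _ `&` _ = D `\` (D `&` g @^-1` E)).
      exact: measurableD.
    by apply/seteqP; split => x; rewrite /g /=; tauto.
  - move=> E mE; rewrite preimage_bigcup setI_bigcupr.
    exact: bigcupT_measurable.
case: H2Z => pZ _ E [[B' SB' ->]|[k [B' [mB' ->]]]|[i [k [B' [mB' ->]]]]] /=.
- rewrite (_ : g @^-1` _ = B'); last by [].
  apply: measurableI => //; apply: (predictable_set_measurable T0 Ft_sigma).
  exact: sub_sigma_algebra.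
(* The y component of [g] is constantly 0, so the preimage is all of [D] or empty. *)
- have [B0|B0] := pselect (B' 0).
    rewrite (_ : D `&` _ = D)//; apply/seteqP; split => x //=; first by case.
    by move=> Dx; rewrite /g /= mxE.
  rewrite (_ : D `&` _ = set0)//; apply/seteqP; split => x //=.
  by case=> _ [_]; rewrite /g /= mxE.
- have := predictable_jointly_measurable T0 Ft_sigma (pZ i k) mD mB'.
  rewrite (_ : D `&` g @^-1` _ = time_space T `&`
    (fun x : X => Z x.1 x.2 i k 0) @^-1` B')//.
  by apply/seteqP; split => x; rewrite /g /=; tauto.
Qed.

Lemma sqnorm_ge0 (v : 'cV[R]_K) : 0 <= sqnorm v.
Proof. by apply: sumr_ge0 => k _; exact: sqr_ge0. Qed.

Lemma sqr_le_sqnorm (v : 'cV[R]_K) (j : 'I_K) : v j 0 ^+ 2 <= sqnorm v.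
Proof.
rewrite /sqnorm (bigD1 j)//= lerDl; apply: sumr_ge0 => k _; exact: sqr_ge0.
Qed.

Let predictable_sqnorm i : predictable T Ft (fun u w => sqnorm (Z u w i)).
Proof.
apply: measurable_sum => k; apply: measurable_funX.
by case: H2Z => /(_ i k).
Qed.

Let phi0 i u w : 0 <= phi i u w. Proof. by case: (phi_density i). Qed.

Let m_phi i : measurable_fun D (fun x : X => phi i x.1 x.2).
Proof.
by case: (phi_density i) => p _ _; apply: (predictable_jointly_measurable T0 Ft_sigma).
Qed.

Let m_term i : measurable_fun D
  (fun x : X => (sqnorm (Z x.1 x.2 i) * phi i x.1 x.2)%:E).
Proof.
apply/measurable_EFinP; apply: measurable_funM => //.
exact: (predictable_jointly_measurable T0 Ft_sigma (predictable_sqnorm i)).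
Qed.

Let term_ge0 i (x : X) : (0 <= (sqnorm (Z x.1 x.2 i) * phi i x.1 x.2)%:E)%E.
Proof. by rewrite lee_fin mulr_ge0// sqnorm_ge0. Qed.

(** Sums and integrals are exchanged on both sides, and the comparison of a density with its bracket
    is applied to each term; the resulting bound is finite by the definition of [H2]. *)
Lemma sqnormM_integral_lty :
  (\int[mu \x P]_(x in D) sqnormM phi x.1 x.2 (Z x.1 x.2) < +oo)%E.
Proof.
case: H2Z => _; apply: le_lt_trans.
have mT : measurable (`[0, T]%classic : set R) by exact: measurable_itv.
rewrite integral_nneseries// [leRHS]integral_nneseries//; last 2 first.
- move=> i; apply: (measurable_kernel_integral (m i) mT (@subset_refl _ _)
    (X := fun u w => sqnorm (Z u w i))).
    exact: (predictable_jointly_measurable T0 Ft_sigma (predictable_sqnorm i)).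
  by move=> *; exact: sqnorm_ge0.
- by move=> i w _; apply: integral_ge0 => t _; rewrite lee_fin sqnorm_ge0.
apply: lee_nneseries => i _ //.
  by move=> _; exact: integral_ge0.
apply: (density_integral_le T0 Ft_sigma (phi_density i) (predictable_sqnorm i)).
by move=> *; exact: sqnorm_ge0.
Qed.

(** The Lipschitz bound between Z and 0, with both y arguments equal to 0, loses its c_t term. The
    constant c has no prescribed sign, hence the factor [|c|]. *)
Lemma driver_sqr_integral_lty (j : 'I_K) :
  (\int[mu \x P]_(x in D) (F x.1 x.2 0 (Z x.1 x.2) j 0 ^+ 2)%:E < +oo)%E.
Proof.
have mF := driver_jointly_measurable j.
have m_sqnormM : measurable_fun D (fun x : X => sqnormM phi x.1 x.2 (Z x.1 x.2)).
  by apply: ge0_emeasurable_sum => // i x _ _; exact: term_ge0.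
have sqnormM_ge0 (x : X) : (0 <= sqnormM phi x.1 x.2 (Z x.1 x.2))%E.
  by apply: nneseries_ge0 => i _ _; exact: term_ge0.
case: stdF => _ _ _ [c [ct [_ _ lipF _]]].
apply: (@le_lt_trans _ _
    (`|c|%:E * \int[mu \x P]_(x in D) sqnormM phi x.1 x.2 (Z x.1 x.2))%E).
  rewrite -ge0_integralZl//.
  apply: ae_ge0_le_integral => //.
  - by move=> x _; rewrite lee_fin sqr_ge0.
  - by apply/measurable_EFinP; exact: measurable_funX.
  - by move=> x _; apply: mule_ge0 => //; rewrite lee_fin.
  - exact: measurable_funeM.
  pose muP : {measure set X -> \bar R} := (mu \x P)%E.
  apply: (@filterS2 _ _ (ae_filter_ringOfSetsType muP) _ _ _ _ lipF nullF).
  move=> x /(_ 0 0 (Z x.1 x.2) (fun=> 0)) lip /(_ 0) null _.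
  apply: le_trans (_ : (sqnorm (F x.1 x.2 0 (Z x.1 x.2)))%:E <= _)%E.
    by rewrite lee_fin sqr_le_sqnorm.
  move: lip; rewrite null !subr0.
  have -> : sqnorm (0 : 'cV[R]_K) = 0.
    by rewrite /sqnorm big1// => k _; rewrite mxE expr0n.
  rewrite mulr0 add0e => /le_trans; apply.
  under eq_fun do rewrite subr0.
  by apply: lee_wpmul2r => //; rewrite lee_fin ler_norm.
by apply: lte_mul_pinfty => //; exact: sqnormM_integral_lty.
Qed.

(** Since |y| <= 1 + y^2 and mu x P is finite, square integrability gives integrability on the
    product, and Fubini gives it on almost every path. *)
Lemma driver_integrable (j : 'I_K) : {ae P, forall w,
  mu.-integrable `[0, T] (EFin \o (fun u => F u w 0 (Z u w) j 0))}.
Proof.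
have mF := driver_jointly_measurable j.
have mFE : measurable_fun D (fun x : X => (F x.1 x.2 0 (Z x.1 x.2) j 0)%:E).
  exact/measurable_EFinP.
have iF : (mu \x P)%E.-integrable D (fun x : X => (F x.1 x.2 0 (Z x.1 x.2) j 0)%:E).
  apply/integrableP; split => //.
  have m2 : measurable_fun D (fun x : X => (F x.1 x.2 0 (Z x.1 x.2) j 0 ^+ 2)%:E).
    by apply/measurable_EFinP; exact: measurable_funX.
  apply: (@le_lt_trans _ _
    (\int[mu \x P]_(x in D) (1 + (F x.1 x.2 0 (Z x.1 x.2) j 0 ^+ 2)%:E))%E).
    apply: ge0_le_integral_nonmeasurable => x _ //=.
    rewrite -EFinD lee_fin.
    set y := F _ _ _ _ _ _; have := sqr_ge0 (`|y| - 1).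
    by rewrite -(real_normK (num_real y)) !expr2; have := normr_ge0 y; nra.
  rewrite ge0_integralD//; last by move=> x _; rewrite lee_fin sqr_ge0.
  apply: lte_add_pinfty; last exact: driver_sqr_integral_lty.
  rewrite integral_cst// mul1e.
  have muPD : (mu \x P)%E D = (mu `[0%R, T]%classic * P setT)%E.
    by apply: product_measure1E => //; exact: measurable_itv.
  apply: (@le_lt_trans _ _ (mu `[0%R, T]%classic * P setT)%E).
    by rewrite -muPD.
  rewrite probability_setT mule1.
  by rewrite ltey_eq fin_num_measure//; exact: measurable_itv.
have := ae_integrable2 ((integrable_mkcond _ mD).1 iF).
apply: filterS => w iw; apply/integrable_mkcond; first exact: measurable_itv.
apply: eq_integrable iw => // u _ /=.
rewrite /patch /D /time_space.
by congr (if _ then _ else _); apply/idP/idP => /set_mem => [[u0 _]|u0]; apply: mem_set.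
Qed.

End integrand.
End drivers.

(** * Comparison of solutions *)

Section bsde_comparison.
Context {R : realType} {K : nat} (T : R).
Context {d : measure_display} {Omega : measurableType d}.
Variables (P : probability Omega R) (Ft : R -> set (set Omega)).
Variable mu : {finite_measure set (measurableTypeR R) -> \bar R}.
Variables (M : nat -> R -> Omega -> R) (m : nat -> R.-sfker Omega ~> measurableTypeR R)
  (phi : nat -> R -> Omega -> R).
Variable F : R -> Omega -> 'cV[R]_K -> (nat -> 'cV[R]_K) -> 'cV[R]_K.
Hypothesis T0 : 0 <= T.
Hypothesis Ft_sigma : forall t : R, 0 <= t <= T ->
  sigma_algebra setT (Ft t) /\ Ft t `<=` measurable.
Hypothesis Ft_nd : forall s t : R, 0 <= s -> s <= t -> t <= T -> Ft s `<=` Ft t.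
Hypothesis aM : forall i, adapted T Ft (M i).
Hypothesis phi_density : forall i, ac_density T P Ft mu (m i) (phi i).
Hypothesis balF : balanced T P Ft mu M m phi F.
Hypothesis Fy : independent_of_y P mu F.
Hypothesis F0 : null_at_zero P mu F.

Let stdF : standard_driver T P Ft mu phi F. Proof. by case: balF. Qed.

Definition restrict_vec (A : set Omega) (s : R) (Z : R -> Omega -> nat -> 'cV[R]_K) :
    R -> Omega -> nat -> 'cV[R]_K :=
  fun u w i => (\1_A w * (s < u)%R%:R) *: Z u w i.

Lemma restrict_vecE A s Z i k :
  (fun u w => restrict_vec A s Z u w i k 0) =
  restrict_integrand A s (fun u w => Z u w i k 0).
Proof. by apply/funext => u; apply/funext => w; rewrite /restrict_vec mxE. Qed.

Lemma restrict_vec_cases A s Z u w :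
  [/\ w \in A, s < u & restrict_vec A s Z u w = Z u w] \/
  \1_A w * (s < u)%R%:R = 0 :> R /\ restrict_vec A s Z u w = fun=> 0.
Proof.
rewrite /restrict_vec indicE; case: (_ \in A) => /=; last first.
  by right; rewrite mul0r; split => //; apply/funext => i; rewrite scale0r.
case: (_ < _) => /=; [left; split => //|right]; rewrite ?mulr1 ?mulr0.
  by apply/funext => i; rewrite scale1r.
by split => //; apply/funext => i; rewrite scale0r.
Qed.

Lemma restrict_vec_H2 A s Z : 0 <= s <= T -> Ft s A -> H2 T P Ft m Z ->
  H2 T P Ft m (restrict_vec A s Z).
Proof.
move=> /andP[s0 sT] FA [pZ iZ]; split=> [i k|].
  rewrite restrict_vecE.
  apply: (@measurable_funM _ (predictable_type T Ft) R (time_space T)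
    (fun x => \1_A x.2 * (s < x.1)%R%:R) (fun x => Z x.1 x.2 i k 0)); last exact: pZ.
  (* Within the time space the scalar factor is the indicator of [C], a generating rectangle of the
     predictable sigma-algebra because A is in F_s. *)
  pose C : set (predictable_type T Ft) := `]s, T]%classic `*` A.
  apply: (@eq_measurable_fun _ _ _ _ _ (\1_C : _ -> R)).
    move=> x /set_mem [x1 _]; rewrite !indicE -natrM mulnb; congr (_ %:R).
    congr nat_of_bool; apply/idP/idP.
      by move=> /set_mem[/=]; rewrite in_itv/= => /andP[-> _] /mem_set ->.
    move=> /andP[/set_mem xA sx]; apply/mem_set; split => //=.
    by move: x1 => /=; rewrite !in_itv/= sx => /andP[_ ->].
  apply: measurable_indic; apply: sub_sigma_algebra; right.
  by exists s, T, A.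
apply: le_lt_trans iZ; apply: ge0_le_integral_nonmeasurable => w _.
  apply: nneseries_ge0 => i _ _; apply: integral_ge0 => u _.
  by rewrite lee_fin sqnorm_ge0.
apply: lee_nneseries => i _.
  by move=> _; apply: integral_ge0 => u _; rewrite lee_fin sqnorm_ge0.
apply: ge0_le_integral_nonmeasurable => u _; rewrite lee_fin ?sqnorm_ge0//.
have [[_ _ ->//]|[_ ->]] := restrict_vec_cases A s Z u w.
rewrite /sqnorm big1; first exact: sqnorm_ge0.
by move=> k _; rewrite mxE expr0n.
Qed.

(** The equations at s and t are subtracted. On almost every path independence of y replaces Y_{u-}
    by 0, and integrability in u permits splitting the integral over ]s, T] at t. *)
Lemma solution_increment (Q : Omega -> 'cV[R]_K)
    (Y : R -> Omega -> 'cV[R]_K) (Z : R -> Omega -> nat -> 'cV[R]_K) (j : 'I_K)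
    (I : R -> Omega -> R) (s t : R) :
  H2 T P Ft m Z -> 0 <= s -> s <= t -> t <= T ->
  (forall t : R, 0 <= t <= T -> {ae P, forall w,
    Q w j 0 = Y t w j 0 - driver_integral mu F Y Z j t T w + (I T w - I t w)}) ->
  {ae P, forall w, Y t w j 0 - Y s w j 0 =
    - (\int[mu]_(u in `]s, t]) F u w 0 (Z u w) j 0) + (I t w - I s w)}.
Proof.
move=> HZ s0 st tT sol.
have sT : 0 <= s <= T by rewrite s0 (le_trans st).
have tT' : 0 <= t <= T by rewrite tT (le_trans s0).
have iF := driver_integrable T0 Ft_sigma phi_density stdF F0 HZ j.
have indep := ae_product_section Fy.
have ae_all := ae_and (ae_and (sol _ sT) (sol _ tT')) (ae_and iF indep).
apply: filterS ae_all => w [[sols solt] [iFw indw]].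
have DI r : driver_integral mu F Y Z j r T w =
    \int[mu]_(u in `]r, T]) F u w 0 (Z u w) j 0.
  rewrite /driver_integral /Rintegral; congr fine.
  apply: ae_eq_integral_nonmeasurable; apply: filterS indw => u Fu _.
  by rewrite (Fu _ 0).
have : \int[mu]_(u in `]s, T]) F u w 0 (Z u w) j 0 =
    \int[mu]_(u in `]s, t]) F u w 0 (Z u w) j 0 +
    \int[mu]_(u in `]t, T]) F u w 0 (Z u w) j 0.
  have itvE : `]s, T]%classic = `]s, t]%classic `|` `]t, T]%classic :> set R.
    by rewrite -itv_bndbnd_setU// bnd_simp.
  rewrite [in LHS]itvE Rintegral_setU//.
  - rewrite -itvE; apply: integrableS iFw => //.
    by apply: subset_itvr; rewrite bnd_simp.
  - apply/disj_setPS => u [] /=; rewrite !in_itv/= => /andP[_ ut] /andP[tu _].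
    by move: (lt_le_trans tu ut); rewrite ltxx.
rewrite -!DI => DIs; move: sols solt; rewrite DIs => -> H.
lra.
Qed.

(** A factor with values 0 and 1 passes through the driver because the driver vanishes at z = 0. *)
Lemma restrict_driver A s Z (y : 'cV[R]_K) u w (j : 'I_K) :
  (forall y y' z, F u w y z = F u w y' z) -> (forall y, F u w y (fun=> 0) = 0) ->
  F u w y (restrict_vec A s Z u w) j 0 =
  \1_A w * (s < u)%R%:R * F u w 0 (Z u w) j 0.
Proof.
move=> Fy' F0'; have [[wA su ->]|[-> ->]] := restrict_vec_cases A s Z u w.
  by rewrite indicE wA su !mul1r (Fy' _ 0).
by rewrite F0' mul0r mxE.
Qed.

(** The mu-integral that is subtracted in the supermartingale of the balance condition. *)
Definition drift (Y : R -> Omega -> 'cV[R]_K) (W W' : R -> Omega -> nat -> 'cV[R]_K)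
    (j : 'I_K) (r : R) (w : Omega) : R :=
  \int[mu]_(u in `]0, r]) (F u w (left_limit Y u w) (W u w) -
                           F u w (left_limit Y u w) (W' u w)) j 0.

(** Both restricted integrands vanish for u <= s, so the drift is 0 at s and reduces to an integral
    over ]s, t] at t, from which the indicators are pulled out. *)
Lemma drift_increment Y A A' Z Z' (j : 'I_K) (s t : R) :
  H2 T P Ft m Z -> H2 T P Ft m Z' -> 0 <= s -> s <= t -> t <= T ->
  {ae P, forall w,
    drift Y (restrict_vec A s Z) (restrict_vec A' s Z') j t w -
    drift Y (restrict_vec A s Z) (restrict_vec A' s Z') j s w =
    \1_A w * \int[mu]_(u in `]s, t]) F u w 0 (Z u w) j 0 -
    \1_A' w * \int[mu]_(u in `]s, t]) F u w 0 (Z' u w) j 0}.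
Proof.
move=> HZ HZ' s0 st tT.
have iF := driver_integrable T0 Ft_sigma phi_density stdF F0 HZ j.
have iF' := driver_integrable T0 Ft_sigma phi_density stdF F0 HZ' j.
have indep := ae_product_section Fy.
have null := ae_product_section F0.
have ae_all := ae_and (ae_and iF iF') (ae_and indep null).
apply: filterS ae_all => w [[iw iw'] [Fyw F0w]].
pose G u := \1_A w * F u w 0 (Z u w) j 0 - \1_A' w * F u w 0 (Z' u w) j 0.
have driftE r : drift Y (restrict_vec A s Z) (restrict_vec A' s Z') j r w =
    \int[mu]_(u in `]0, r] `&` `]s, +oo[) G u.
  rewrite Rintegral_mkcondr /drift /Rintegral; congr fine.
  apply: ae_eq_integral_nonmeasurable; apply: filterS2 Fyw F0w => u Fyu F0u _.
  rewrite !mxE !restrict_driver// /patch /G.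
  case: ifPn => [/set_mem/=|]; first by rewrite in_itv/= andbT => ->; rewrite !mulr1.
  by rewrite mem_setE in_itv/= andbT => /negbTE ->; rewrite !mulr0 !mul0r subrr.
rewrite !driftE.
have -> : `]0, s]%classic `&` `]s, +oo[%classic = set0 :> set R.
  apply/seteqP; split => u //= [] ; rewrite !in_itv/= andbT => /andP[_ us] su.
  by move: (lt_le_trans su us); rewrite ltxx.
have -> : `]0, t]%classic `&` `]s, +oo[%classic = `]s, t]%classic :> set R.
  apply/seteqP; split => u /=; rewrite !in_itv/= ?andbT.
    by move=> [/andP[_ ->] ->].
  by move=> /andP[su ->]; rewrite su (le_lt_trans s0).
rewrite Rintegral_set0 subr0.
have mst : measurable (`]s, t]%classic : set (measurableTypeR R)) by exact: measurable_itv.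
have sub : (`]s, t]%classic : set R) `<=` `[0, T]%classic.
  move=> u /=; rewrite !in_itv/= => /andP[su ut].
  by rewrite (le_trans s0 (ltW su)) (le_trans ut).
have m0T : measurable (`[0, T]%classic : set (measurableTypeR R)) by exact: measurable_itv.
have ist := integrableS m0T mst sub iw.
have ist' := integrableS m0T mst sub iw'.
rewrite /G RintegralB// ?RintegralZl//.
  by apply: (eq_integrable mst) (integrableZl mst (\1_A w) ist) => u _.
by apply: (eq_integrable mst) (integrableZl mst (\1_A' w) ist') => u _.
Qed.

Lemma restrict_stoch_integral A A' (s : R) Z Z' I I' (j : 'I_K) :
  0 <= s <= T -> Ft s A -> Ft s A' -> H2 T P Ft m Z -> H2 T P Ft m Z' ->
  stoch_integral_sum T P Ft M m (fun i u w => Z u w i j 0) I ->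
  stoch_integral_sum T P Ft M m (fun i u w => Z' u w i j 0) I' ->
  stoch_integral_sum T P Ft M m
    (fun i u w => (restrict_vec A s Z u w i - restrict_vec A' s Z' u w i) j 0)
    (fun r w => restrict_process A s I r w - restrict_process A' s I' r w).
Proof.
move=> sT FA FA' HZ HZ' ZI ZI'.
have RI := stoch_integral_sum_restrict Ft_sigma Ft_nd aM sT FA ZI.
have RI' := stoch_integral_sum_restrict Ft_sigma Ft_nd aM sT FA' ZI'.
have pR B Z1 : Ft s B -> H2 T P Ft m Z1 -> forall i,
    predictable T Ft (restrict_integrand B s (fun u w => Z1 u w i j 0)).
  by move=> FB /(restrict_vec_H2 sT FB)[+ _] i => /(_ i j); rewrite restrict_vecE.
have := stoch_integral_sumB T0 Ft_sigma aM (pR _ _ FA HZ) (pR _ _ FA' HZ') RI RI'.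
congr stoch_integral_sum; apply/funext => i; apply/funext => u; apply/funext => w.
by rewrite !mxE /restrict_integrand.
Qed.

(* The supermartingale of the balanced driver for the integrands 1_A 1_]s, T] Z
   and 1_A' 1_]s, T] Z' grows on [s, T] exactly like 1_A Y - 1_A' Y'. *)
Lemma solution_comparison Q Q' Y Y' Z Z' (A A' : set Omega) (C : Omega -> R)
    (j : 'I_K) (s t : R) :
  bsde_solution T P Ft mu M m F Q Y Z -> bsde_solution T P Ft mu M m F Q' Y' Z' ->
  0 <= s -> s <= t -> t <= T -> Ft s A -> Ft s A' -> wrt_measurable (Ft s) C ->
  {ae P, forall w, 0 <= \1_A w * Y t w j 0 - \1_A' w * Y' t w j 0 + C w} ->
  {ae P, forall w, 0 <= \1_A w * Y s w j 0 - \1_A' w * Y' s w j 0 + C w} /\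
  ({ae P, forall w, \1_A w * Y s w j 0 - \1_A' w * Y' s w j 0 + C w = 0} ->
   {ae P, forall w, \1_A w * Y t w j 0 - \1_A' w * Y' t w j 0 + C w = 0}).
Proof.
move=> [SY HZ solY] [SY' HZ' solY'] s0 st tT FA FA' mC Yt_ge0.
have sT : 0 <= s <= T by rewrite s0 (le_trans st).
have [I ZI eqY] := solY j; have [I' ZI' eqY'] := solY' j.
pose W := restrict_vec A s Z; pose W' := restrict_vec A' s Z'.
have HW : H2 T P Ft m W by exact: restrict_vec_H2.
have HW' : H2 T P Ft m W' by exact: restrict_vec_H2.
(* The measures are those for the restricted integrands, so they may depend on s, A and A'. *)
have [Pt [PPt superX _]] := balF.2 Y Y' W W' SY SY' HW HW'.
have := superX j _ (restrict_stoch_integral sT FA FA' HZ HZ' ZI ZI').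
set X := (X in supermartingale _ _ _ X) => superXj.
pose D w := \1_A w * Y s w j 0 - \1_A' w * Y' s w j 0 + C w.
have mD : wrt_measurable (Ft s) D.
  have [sF _] := Ft_sigma sT; case: SY SY' => aY _ _ [aY' _ _].
  apply: wrt_measurableD => //; apply: wrt_measurableB => //;
    apply: wrt_measurableM => //; try exact: wrt_measurable_indic.
  - exact: aY sT.
  - exact: aY' sT.
have VE : {ae P, forall w, D w + (X t w - X s w) =
    \1_A w * Y t w j 0 - \1_A' w * Y' t w j 0 + C w}.
  have incY := solution_increment HZ s0 st tT eqY.
  have incY' := solution_increment HZ' s0 st tT eqY'.
  have incX := drift_increment Y' A A' j HZ HZ' s0 st tT.
  have ae_all := ae_and incX (ae_and incY incY').
  apply: filterS ae_all => w [incXw [incYw incYw']].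
  rewrite /X -/(drift Y' W W' j t w) -/(drift Y' W W' j s w).
  (* The restricted integrals vanish at s and equal 1_A (I_t - I_s) and 1_A' (I'_t - I'_s) at t. *)
  rewrite /restrict_process (min_idPr st) minxx !subrr !mulr0.
  move: incXw incYw incYw'; rewrite -/W -/W' /D; nra.
have V0 : {ae P, forall w, 0 <= D w + (X t w - X s w)}.
  by apply: filterS2 VE Yt_ge0 => w ->.
split; first exact: (supermartingale_comparison Ft_sigma (PPt j) superXj s0 st tT mD V0).
move=> D0.
have := supermartingale_comparison_eq0 Ft_sigma (PPt j) superXj s0 st tT mD V0 D0.
by apply: filterS2 VE => w ->.
Qed.

(** The comparison is applied twice, the second time with the solutions and events exchanged and C
    replaced by -C, which yields both inequalities at time s. *)
Lemma solution_uniqueness Q Q' Y Y' Z Z' (A A' : set Omega) (C : Omega -> R)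
    (j : 'I_K) (s t : R) :
  bsde_solution T P Ft mu M m F Q Y Z -> bsde_solution T P Ft mu M m F Q' Y' Z' ->
  0 <= s -> s <= t -> t <= T -> Ft s A -> Ft s A' -> wrt_measurable (Ft s) C ->
  {ae P, forall w, \1_A w * Y t w j 0 - \1_A' w * Y' t w j 0 + C w = 0} ->
  {ae P, forall w, \1_A w * Y s w j 0 - \1_A' w * Y' s w j 0 + C w = 0}.
Proof.
move=> sol sol' s0 st tT FA FA' mC Yt0.
have sT : 0 <= s <= T by rewrite s0 (le_trans st).
have mNC : wrt_measurable (Ft s) (fun w => - C w).
  by apply: wrt_measurableN => //; case: (Ft_sigma sT).
have [|ge0 _] := solution_comparison sol sol' s0 st tT FA FA' mC (j := j).
  by apply: filterS Yt0 => w ->.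
have [|le0 _] := solution_comparison sol' sol s0 st tT FA' FA mNC (j := j).
  by apply: filterS Yt0 => w; lra.
by apply: filterS2 ge0 le0 => w; lra.
Qed.

Lemma solution_terminal Q Y Z (j : 'I_K) : bsde_solution T P Ft mu M m F Q Y Z ->
  {ae P, forall w, Y T w j 0 = Q w j 0}.
Proof.
case=> _ _ /(_ j)[I _ /(_ T)]; rewrite T0 lexx => /(_ isT).
apply: filterS => w ->.
by rewrite /driver_integral set_itvoc0 Rintegral_set0 !subrr addr0 subr0.
Qed.

End bsde_comparison.

(** * Almost sure relations between vectors, and square-integrable vectors *)

Lemma ae_ord_forall {d} {X : measurableType d} {R : realType} (n : nat)
    (mu : {measure set X -> \bar R}) (A : 'I_n -> X -> Prop) :
  (forall i, {ae mu, forall x, A i x}) -> {ae mu, forall x, forall i, A i x}.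
Proof.
move=> Ai.
have := @ae_foralln _ _ _ mu (fun k x => forall i : 'I_n, i = k :> nat -> A i x).
case=> [k|N [mN N0 NA]].
  have [kn|nk] := ltnP k n; last first.
    by apply: aeW => x i ik; move: (ltn_ord i); rewrite ik ltnNge nk.
  apply: filterS (Ai (Ordinal kn)) => x Ax i ik.
  by rewrite (_ : i = Ordinal kn)//; exact: val_inj.
exists N; split => // x nA; apply: NA; apply: contra_not nA => Ax i.
exact: (Ax i i).
Qed.

Lemma ae_cv_eq {R : realType} {K : nat} {d} {X : measurableType d}
    (mu : {measure set X -> \bar R}) (u v : X -> 'cV[R]_K) :
  (forall j, {ae mu, forall x, u x j 0 = v x j 0}) -> {ae mu, forall x, u x = v x}.
Proof.
move=> uv; apply: filterS (ae_ord_forall uv) => x uvx.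
by apply/matrixP => i j; rewrite ord1.
Qed.

Section L2_vectors.
Context {R : realType} {K : nat} {d : measure_display} {Omega : measurableType d}.
Variable P : probability Omega R.
Implicit Types (G H : set (set Omega)) (Q : Omega -> 'cV[R]_K).

Lemma L2vecS G H Q : G `<=` H -> L2vec P G Q -> L2vec P H Q.
Proof. by move=> GH [mQ iQ]; split=> // k; exact: wrt_measurableS (mQ k). Qed.

Lemma L2vec_indic G A Q : sigma_algebra setT G -> G A ->
  L2vec P G Q -> L2vec P G (fun w => \1_A w *: Q w).
Proof.
move=> sG GA [mQ iQ]; split=> [k|].
  rewrite (_ : (fun w => _) = fun w => \1_A w * Q w k 0).
    by apply: wrt_measurableM => //; exact: wrt_measurable_indic.
  by apply/funext => w; rewrite mxE.
apply: le_lt_trans iQ; apply: ge0_le_integral_nonmeasurable => w _.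
  by rewrite lee_fin sqnorm_ge0.
rewrite lee_fin indicE; case: (_ \in A); rewrite ?scale1r// scale0r.
rewrite /sqnorm big1; first exact: sqnorm_ge0.
by move=> k _; rewrite mxE expr0n.
Qed.

Lemma S2_L2vec (T : R) (Ft : R -> set (set Omega)) (Y : R -> Omega -> 'cV[R]_K) t :
  S2 T P Ft Y -> 0 <= t <= T -> L2vec P (Ft t) (Y t).
Proof.
move=> [aY _ iY] tT; split=> [k|]; first exact: aY.
apply: le_lt_trans iY; apply: ge0_le_integral_nonmeasurable => w _.
  by rewrite lee_fin sqnorm_ge0.
by apply: ereal_sup_ubound; exists t => //=; rewrite in_itv.
Qed.

End L2_vectors.

(** * The properties of a consistent nonlinear expectation *)

Theorem theorem8p1 (R : realType) (K : nat) (T : R) (hT : 0 < T)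
    (d : measure_display) (Omega : measurableType d) (P : probability Omega R)
    (Ft : R -> set (set Omega))
    (hFt : usual_conditions T P Ft)
    (hF0 : trivial_sigma_algebra P (Ft 0))
    (hsep : L2_separable P (Ft T))
    (M : nat -> R -> Omega -> R)
    (m : nat -> R.-sfker Omega ~> measurableTypeR R)
    (hM : davis_varaiya T P Ft M m)
    (mu : {finite_measure set (measurableTypeR R) -> \bar R})
    (hmu : stieltjes_measure T mu)
    (phi : nat -> R -> Omega -> R)
    (hphi : forall i, ac_density T P Ft mu (m i) (phi i))
    (F : R -> Omega -> 'cV[R]_K -> (nat -> 'cV[R]_K) -> 'cV[R]_K)
    (hF : balanced T P Ft mu M m phi F)
    (hFy : independent_of_y P mu F)
    (hFz : null_at_zero P mu F)
    (E : (Omega -> 'cV[R]_K) -> R -> Omega -> 'cV[R]_K)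
    (hE : bsde_expectation T P Ft mu M m F E) :
  consistent_expectation T P Ft E.
Proof.
have T0 : 0 <= T by exact: ltW.
have T0T : 0 <= T <= T by rewrite T0 lexx.
have [Fsig Fnd _ _] := hFt.
have aM i : adapted T Ft (M i) by case: hM => /(_ i)[[[]]].
have FsT t : 0 <= t <= T -> Ft t setT.
  by case/Fsig => -[F0 FD _] _; rewrite -(setD0 setT); exact: FD.
have FsT0 t : 0 <= t <= T -> Ft t set0 by case/Fsig => -[].
have m0 t : 0 <= t <= T -> wrt_measurable (Ft t) (fun=> 0 : R).
  by move=> /Fsig[sF _]; exact: wrt_measurable_cst.
have compare := solution_comparison T0 Fsig Fnd aM hphi hF hFy hFz.
have unique := solution_uniqueness T0 Fsig Fnd aM hphi hF hFy hFz.
have terminal Q Y Z j : bsde_solution T P Ft mu M m F Q Y Z ->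
    {ae P, forall w, Y T w j 0 = Q w j 0} by exact: solution_terminal.
have ET Q : L2vec P (Ft T) Q -> forall j, {ae P, forall w, E Q T w j 0 = Q w j 0}.
  by move=> /hE[Z sol] j; exact: terminal sol.
have EL2 t Q : 0 <= t <= T -> L2vec P (Ft T) Q -> L2vec P (Ft t) (E Q t).
  by move=> tT /hE[Z [SE _ _]]; exact: S2_L2vec SE tT.
have FtT t : 0 <= t <= T -> Ft t `<=` Ft T.
  by move=> /andP[t0 tT]; exact: Fnd.
have EQt t Q : 0 <= t <= T -> L2vec P (Ft t) Q -> {ae P, forall w, E Q t w = Q w}.
  move=> tT Q2; have QT := L2vecS (FtT t tT) Q2; have [Z sol] := hE Q QT.
  have /andP[t0 tT'] := tT; apply: ae_cv_eq => j.
  have mQ : wrt_measurable (Ft t) (fun w => - Q w j 0).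
    by apply: wrt_measurableN; [case: (Fsig t tT)|case: Q2].
  (* The compared quantity is E(Q | F_r) - Q, which is 0 at r = T. Taking C = -Q is allowed because
     Q is measurable for F_t; since A' is empty, [sol] can also fill the place of the second
     solution. *)
  have := unique _ _ _ _ _ _ setT set0 _ j _ _ sol sol t0 tT' (lexx T)
    (FsT t tT) (FsT0 t tT) mQ.
  have Et : {ae P, forall w, \1_setT w * E Q T w j 0 - \1_set0 w * E Q T w j 0
      + - Q w j 0 = 0}.
    apply: filterS (ET Q QT j) => w ->.
    by rewrite indicT indic0 /cst; ring.
  by move=> /(_ Et); apply: filterS => w; rewrite indicT indic0 /cst; lra.
have Emono t Q Q' : 0 <= t <= T -> L2vec P (Ft T) Q -> L2vec P (Ft T) Q' ->
    {ae P, forall w, cvle (Q' w) (Q w)} -> forall j,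
    {ae P, forall w, E Q' t w j 0 <= E Q t w j 0} /\
    ({ae P, forall w, E Q t w j 0 = E Q' t w j 0} ->
     {ae P, forall w, Q w j 0 = Q' w j 0}).
  move=> tT Q2 Q2' QQ' j; have [Z sol] := hE Q Q2; have [Z' sol'] := hE Q' Q2'.
  have /andP[t0 tT'] := tT.
  (* On [t, T] the first conclusion of the comparison is monotonicity; the second carries equality
     at t forward to the terminal values. *)
  have := compare _ _ _ _ _ _ setT setT _ j _ _ sol sol' t0 tT' (lexx T)
    (FsT t tT) (FsT t tT) (m0 t tT).
  have D0 : {ae P, forall w, 0 <= \1_setT w * E Q T w j 0
      - \1_setT w * E Q' T w j 0 + 0}.
    have := ae_and QQ' (ae_and (ET Q Q2 j) (ET Q' Q2' j)).
    apply: filterS => w [QQw [e1 e2]]; rewrite indicT /cst e1 e2.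
    by have := QQw j; lra.
  move=> /(_ D0)[Dt Dt0]; split.
    by apply: filterS Dt => w; rewrite indicT /cst; lra.
  move=> EE; have Et : {ae P, forall w, \1_setT w * E Q t w j 0
      - \1_setT w * E Q' t w j 0 + 0 = 0}.
    by apply: filterS EE => w ->; rewrite indicT /cst; lra.
  have := ae_and (Dt0 Et) (ae_and (ET Q Q2 j) (ET Q' Q2' j)).
  by apply: filterS => w [e [e1 e2]]; move: e; rewrite e1 e2 indicT /cst; lra.
split.
- exact: EL2.
- move=> t Q Q' tT Q2 Q2' QQ'; split.
    by apply: ae_ord_forall => j; have [] := Emono t Q Q' tT Q2 Q2' QQ' j.
  split=> [EE|QE].
    apply: ae_cv_eq => j; have [_] := Emono t Q Q' tT Q2 Q2' QQ' j; apply.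
    by apply: filterS EE => w ->.
  (* Equal terminal values are ordered both ways, so monotonicity and antisymmetry give equality at
     t. *)
  have Q'Q : {ae P, forall w, cvle (Q w) (Q' w)}.
    by apply: filterS QE => w -> k.
  apply: ae_cv_eq => j.
  have [le1 _] := Emono t Q Q' tT Q2 Q2' QQ' j.
  have [le2 _] := Emono t Q' Q tT Q2' Q2 Q'Q j.
  by apply: filterS2 le1 le2 => w l1 l2; apply: le_anti; rewrite l1 l2.
- exact: EQt.
- move=> s t Q s0 st tT Q2.
  have tT' : 0 <= t <= T by rewrite tT (le_trans s0).
  have sT : 0 <= s <= T by rewrite s0 (le_trans st).
  have Et2 := L2vecS (FtT t tT') (EL2 t Q tT' Q2).
  have [Z sol] := hE Q Q2; have [Z' sol'] := hE _ Et2.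
  apply: ae_cv_eq => j.
  (* The two solutions agree at t by property (2), applied to the F_t-measurable E(Q | F_t);
     uniqueness takes this back to s. *)
  have := unique _ _ _ _ _ _ setT setT _ j _ _ sol' sol s0 st tT
    (FsT s sT) (FsT s sT) (m0 s sT).
  have Dt : {ae P, forall w, \1_setT w * E (E Q t) t w j 0
      - \1_setT w * E Q t w j 0 + 0 = 0}.
    apply: filterS (EQt t (E Q t) tT' (EL2 t Q tT' Q2)) => w ->.
    by rewrite addr0 subrr.
  by move=> /(_ Dt); apply: filterS => w; rewrite indicT /cst; lra.
move=> t A Q tT FA Q2; have /andP[t0 tT'] := tT.
have AQ2 : L2vec P (Ft T) (fun w => \1_A w *: Q w).
  by apply: L2vec_indic => //; [case: (Fsig T T0T)|exact: FtT FA].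
have [Z sol] := hE Q Q2; have [Z' sol'] := hE _ AQ2.
apply: ae_cv_eq => j.
(* At time T both 1_A E(Q | F_T) and E(1_A Q | F_T) are 1_A Q. *)
have := unique _ _ _ _ _ _ A setT _ j _ _ sol sol' t0 tT' (lexx T)
  FA (FsT t tT) (m0 t tT).
have DT : {ae P, forall w, \1_A w * E Q T w j 0
    - \1_setT w * E (fun w' => \1_A w' *: Q w') T w j 0 + 0 = 0}.
  apply: filterS2 (ET Q Q2 j) (ET _ AQ2 j) => w -> ->.
  by rewrite mxE indicT /cst mul1r addr0 subrr.
by move=> /(_ DT); apply: filterS => w; rewrite mxE indicT /cst; lra.
Qed.
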